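(* Suppose $\sigma<2$ is a constant, $\Omega$ is a compact subset of $\mathbb{R}^n$, $n\ge 3$, and $f:(0,\infty)\to(0,\infty)$ is a continuous function satisfying $$\liminf_{s\to 0^+}\frac{f(s)}{s^{1+\frac{4-\sigma}{n-2}}}>0\quad\text{and}\quad \lim_{s\to\infty}\frac{f(s)}{s^{-1+\frac{\sigma}{2}}}=\infty.$$ Then there does not exist a $C^4$ positive solution $v(y)$ of $$-\Delta^2 v\ge |y|^{-\sigma}f(v)$$ in $\mathbb{R}^n\setminus\Omega$.
   Context: $\Delta^2=\Delta\circ\Delta$ is the biharmonic operator. A $C^4$ positive solution is a $C^4$ function $v>0$ satisfying the inequality pointwise. *)

(* Defs.v *)
From mathcomp Require Import all_boot all_order all_algebra.
From mathcomp Require Import all_classical all_reals all_analysis.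

Set Implicit Arguments.
Unset Strict Implicit.
Unset Printing Implicit Defensive.

Import Order.TTheory GRing.Theory Num.Theory.
Import numFieldNormedType.Exports.

Local Open Scope classical_set_scope.
Local Open Scope ring_scope.

(* The library norm on 'rV[R]_n is the sup norm; it induces the same topology,
   but the Euclidean length has to be spelled out. *)
Definition euclidean_norm (R : realType) (n : nat) (y : 'rV[R]_n) : R :=
  Num.sqrt (\sum_(i < n) y 0 i ^+ 2).

Definition partial (R : realType) (n : nat) (i : 'I_n) (v : 'rV[R]_n -> R) :
    'rV[R]_n -> R :=
  fun y => 'D_(delta_mx 0 i) v y.

Definition laplacian (R : realType) (n : nat) (v : 'rV[R]_n -> R) :
    'rV[R]_n -> R :=
  fun y => \sum_(i < n) partial i (partial i v) y.

(* Meant for open U: functions on U are represented by total functions, whose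
   values outside of U are then irrelevant to derivatives at points of U. *)
Fixpoint Ck_on (R : realType) (n : nat) (U : set 'rV[R]_n) (k : nat)
    (v : 'rV[R]_n -> R) : Prop :=
  {in U, continuous v} /\
  if k is k'.+1 then
    forall i : 'I_n,
      {in U, forall y, derivable v y (delta_mx 0 i)} /\
      Ck_on U k' (partial i v)
  else True.

(* Main.v *)
Require Import Defs.
From mathcomp Require Import all_boot all_order all_algebra.
From mathcomp Require Import all_classical all_reals all_analysis.
From mathcomp Require Import ring lra.

(* Average everything over spheres.  If V, W and G denote the spherical means
   of v, Delta v and - Delta^2 v, then V'' + (n-1) V'/r = W and
   W'' + (n-1) W'/r = - G with V > 0 and G >= 0.

   On a ball, Delta^2 v <= 0 makes the mean of v a concave function of the
   square of the radius; with v > 0 this bounds v(x) by a multiple of the mean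
   V near |x|, so v is nowhere much larger than its mean and G can be bounded
   below in terms of V alone.  If r^(n-1) W' becomes negative, or if Delta v
   has a positive mean, or if V stays away from 0, then V is nondecreasing,
   doubling and O(r^2), hence G >= c r^-2 and integrating twice contradicts
   the sign of W or V.  Otherwise V decays, S = - r^(n-1) V' is positive and
   nondecreasing, V >= c S r^(2-n), and the growth of f at 0 gives
   S' >= c S^p / r with p > 1: S blows up at a finite radius.

   No integration theory on R^n is used: the means are taken against a smooth
   radial weight, for a positive functional that is the limit of Riemann sums
   along an ultrafilter. *)

Set Implicit Arguments.
Unset Strict Implicit.
Unset Printing Implicit Defensive.

Import Order.TTheory GRing.Theory Num.Theory.
Import numFieldNormedType.Exports.

Local Open Scope classical_set_scope.
Local Open Scope ring_scope.

(** * One-variable calculus *)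

(** The obstacle is that [f] is neither monotone nor convex, so Jensen's inequality cannot be
    applied to it. The pointwise bound of [v] by its mean removes this: once [v <= X] on a ring,
    with [X] controlled by [V], the hypotheses give [f v >= m (v / V)^p] with [m] constant on the
    ring, and only the convexity of [x^p] is left to use. The exponents are exactly the borderline
    ones. With [p] the exponent at 0, [(n - 2) p = n + 2 - sigma], so the powers of [r] cancel when
    [r^(n-2) V >= c S] is inserted and [S^p / r] remains. If [V = O(r^2)], the power
    [-1 + sigma / 2] of [V] times [r^-sigma] is at least a multiple of [r^-2], for which integration
    still diverges logarithmically. The means are not literally spherical: [V t] averages [v (t z)]
    over a fixed ring of [z]. Each Laplacian in [t] brings out a factor [|z|^2], so [V], [W] and [G]
    carry the weights [b], [|z|^2 b] and [|z|^4 b], and the radial equations hold exactly. *)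

Section DerivativeRules.
Context {R : realType} {V : normedModType R}.
Implicit Types (f g : V -> R) (x v : V) (a b : R).

Lemma deriv_cst x v a : is_derive x v (fun=> a) 0.
Proof. exact: is_derive_cst. Qed.

Lemma deriv_add f g x v a b : is_derive x v f a -> is_derive x v g b ->
  is_derive x v (fun y => f y + g y) (a + b).
Proof. by move=> fa gb; exact: is_deriveD. Qed.

Lemma deriv_opp f x v a : is_derive x v f a -> is_derive x v (fun y => - f y) (- a).
Proof. by move=> fa; exact: is_deriveN. Qed.

Lemma deriv_mul f g x v a b : is_derive x v f a -> is_derive x v g b ->
  is_derive x v (fun y => f y * g y) (a * g x + f x * b).
Proof.
move=> fa gb; apply: (is_derive_eq (is_deriveM fa gb)).
by rewrite /GRing.scale /= addrC; congr (_ + _); rewrite mulrC.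
Qed.

Lemma deriv_exp f x v a k : is_derive x v f a ->
  is_derive x v (fun y => f y ^+ k) (k%:R * f x ^+ k.-1 * a).
Proof.
move=> fa; have -> : (fun y => f y ^+ k) = f ^+ k by apply/funext => y; rewrite exprfctE.
exact: is_deriveX.
Qed.

Lemma deriv_sum n (f : 'I_n -> V -> R) x v (df : 'I_n -> R) :
  (forall i, is_derive x v (f i) (df i)) ->
  is_derive x v (fun y => \sum_i f i y) (\sum_i df i).
Proof.
move=> fdf; have -> : (fun y => \sum_i f i y) = \sum_i f i.
  by apply/funext => y; rewrite fct_sumE.
exact: is_derive_sum.
Qed.
End DerivativeRules.

Section DerivativeRules1.
Context {R : realType}.
Implicit Types (f g : R -> R) (x a b : R).

Lemma deriv_id x : is_derive x 1 (fun t : R => t) 1.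
Proof. exact: is_derive_id. Qed.

Lemma deriv_inv f x a : f x != 0 -> is_derive x 1 f a ->
  is_derive x 1 (fun t => (f t)^-1) (- (f x ^- 2) * a).
Proof. by move=> fx0 fa; exact: is_deriveV. Qed.

Lemma deriv_invr x : x != 0 -> is_derive x 1 (@GRing.inv R) (- (x ^- 2)).
Proof.
move=> x0; apply: (is_derive_eq (@deriv_inv (fun t => t) x _ x0 (deriv_id x))).
by rewrite mulr1.
Qed.

Lemma deriv_continuous f x a : is_derive x 1 f a -> {for x, continuous f}.
Proof. by case=> fx _; apply/differentiable_continuous/derivable1_diffP. Qed.

Lemma ge0_deriv_le {f df : R -> R} {a b} : a <= b ->
  (forall x, a <= x <= b -> is_derive x 1 f (df x)) ->
  (forall x, a < x < b -> 0 <= df x) -> f a <= f b.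
Proof.
rewrite le_eqVlt => /predU1P[->//|ab] fdf df0.
have [||c + fE] := @MVT R f df a b ab.
- by move=> x; rewrite in_itv /= => /andP[? ?]; apply: fdf; lra.
- apply: derivable_within_continuous => x; rewrite in_itv /= => xab.
  by case: (fdf x xab).
- rewrite in_itv /= => /df0 c0; rewrite -subr_ge0 fE mulr_ge0 //; lra.
Qed.

Lemma deriv_le_le {f df g dg : R -> R} {a b} : a <= b ->
  (forall x, a <= x <= b -> is_derive x 1 f (df x)) ->
  (forall x, a <= x <= b -> is_derive x 1 g (dg x)) ->
  (forall x, a < x < b -> df x <= dg x) -> f b - f a <= g b - g a.
Proof.
move=> ab fdf gdg dfg.
suff: g a - f a <= g b - f b by lra.
apply: (@ge0_deriv_le (fun x => g x - f x) (fun x => dg x - df x)) => // x abx.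
- by apply: deriv_add; [exact: gdg|apply: deriv_opp; exact: fdf].
- by rewrite subr_ge0 dfg.
Qed.
End DerivativeRules1.

Ltac deriv :=
  lazymatch goal with
  | |- is_derive _ _ (fun t => t) _ => eapply deriv_id
  | |- is_derive _ _ (fun _ => ?c) _ => eapply deriv_cst
  | |- is_derive _ _ (fun t => _ + _) _ => eapply deriv_add; [deriv|deriv]
  | |- is_derive _ _ (fun t => - _) _ => eapply deriv_opp; deriv
  | |- is_derive _ _ (fun t => _ * _) _ => eapply deriv_mul; [deriv|deriv]
  | |- is_derive _ _ (fun t => _ ^+ _) _ => eapply deriv_exp; deriv
  | |- is_derive _ _ (fun t => _ ^-1) _ => eapply deriv_inv; [|deriv]
  | |- is_derive _ _ GRing.inv _ => eapply deriv_invr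
  | |- is_derive _ _ (ln (R:=_)) _ => eapply is_derive1_ln
  | |- _ => first [eassumption | idtac]
  end.
Ltac der := eapply is_derive_eq; [deriv|]; cbv beta.

(** * Radial profiles *)

(* [H] and [W] are radial profiles in dimension [k + 3] with [Delta H = W] and
   [Delta W = - G], written so that the equations make sense at [t = 0]. *)
Definition radial_system {R : realType} (k : nat) (D : set R)
    (H H1 H2 W W1 W2 G : R -> R) : Prop :=
  forall t, D t ->
  [/\ is_derive t 1 H (H1 t) /\ is_derive t 1 H1 (H2 t),
      is_derive t 1 W (W1 t) /\ is_derive t 1 W1 (W2 t),
      t * H2 t + k.+2%:R * H1 t = t * W t &
      t * W2 t + k.+2%:R * W1 t = - (t * G t)].

(** With [n = k + 3] the factor is [t^(n-1)]. For [U] a radial derivative this is, up to a constant,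
    the flux through a sphere, which turns each second-order equation into divergence form. *)
Definition radial_flux {R : realType} (k : nat) (U : R -> R) (t : R) : R :=
  t ^+ k.+2 * U t.

(** It is zero for [H = c t^2]. For [t > 0] its sign is that of the derivative of [H1 t / t], hence
    of the second derivative of [H] in the variable [t^2]. Differentiating it cancels [W] and leaves
    only the flux of [W1]. *)
Definition radial_defect {R : realType} (k : nat) (H1 W : R -> R) (t : R) : R :=
  t ^+ k.+3 * W t - k.+3%:R * radial_flux k H1 t.

Section RadialSystem.
Context {R : realType} {k : nat} {D : set R} {H H1 H2 W W1 W2 G : R -> R}.
Hypothesis sys : radial_system k D H H1 H2 W W1 W2 G.
Implicit Types t a b : R.

Lemma radial_flux_deriv t : D t ->
  is_derive t 1 (radial_flux k H1) (t ^+ k.+2 * W t).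
Proof.
rewrite /radial_flux.
move=> /sys[[_ dH1] _ eqH _]; der.
rewrite /= mulr1.
transitivity (t ^+ k.+1 * (t * H2 t + k.+2%:R * H1 t)); last by rewrite eqH !exprS; ring.
by rewrite !exprS; ring.
Qed.

Lemma radial_flux_deriv2 t : D t ->
  is_derive t 1 (radial_flux k W1) (- (t ^+ k.+2 * G t)).
Proof.
rewrite /radial_flux.
move=> /sys[_ [_ dW1] _ eqW]; der.
rewrite /= mulr1.
transitivity (t ^+ k.+1 * (t * W2 t + k.+2%:R * W1 t)); last by rewrite eqW !exprS; ring.
by rewrite !exprS; ring.
Qed.

Lemma radial_defect_deriv t : D t ->
  is_derive t 1 (radial_defect k H1 W) (t * radial_flux k W1 t).
Proof.
move=> Dt; have dP := radial_flux_deriv Dt; have [_ [dW _] _ _] := sys Dt.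
rewrite /radial_defect; eapply is_derive_eq.
  eapply deriv_add; [deriv|].
  eapply deriv_opp; eapply deriv_mul; [exact: deriv_cst|exact: dP].
by cbv beta; rewrite /radial_flux /= mulr1 mul0r add0r !exprS; ring.
Qed.

Lemma radial_quotient_deriv t : D t -> 0 < t ->
  is_derive t 1 (fun x => H1 x * x^-1) (radial_defect k H1 W t * t ^- k.+4).
Proof.
move=> Dt t0; have [[_ dH1] _ eqH _] := sys Dt; der; first by rewrite gt_eqF.
have -> : H2 t = W t - k.+2%:R * H1 t / t.
  apply: (mulfI (lt0r_neq0 t0)); rewrite mulrBr -eqH; field; exact: lt0r_neq0.
rewrite /radial_defect /radial_flux !exprS (natrD _ 1 k.+2).
field; rewrite expf_neq0 lt0r_neq0 //.
Qed.
End RadialSystem.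

(** * Concavity in the square of the radius *)

Section RadialConvexity.
Context {R : realType}.

Lemma slope_ge_increment (H H1 : R -> R) (m a b : R) : a <= b ->
  (forall t, a <= t <= b -> is_derive t 1 H (H1 t)) ->
  (forall t, a < t < b -> m * t <= H1 t) ->
  m * (b ^+ 2 - a ^+ 2) / 2 <= H b - H a.
Proof.
move=> ab dH mH1.
have -> : m * (b ^+ 2 - a ^+ 2) / 2 = m / 2 * b ^+ 2 - m / 2 * a ^+ 2 by ring.
apply: (@deriv_le_le _ (fun t => m / 2 * t ^+ 2) (fun t => m * t)) => // t tab.
by der; field.
Qed.

Lemma slope_le_increment (H H1 : R -> R) (m a b : R) : a <= b ->
  (forall t, a <= t <= b -> is_derive t 1 H (H1 t)) ->
  (forall t, a < t < b -> H1 t <= m * t) ->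
  H b - H a <= m * (b ^+ 2 - a ^+ 2) / 2.
Proof.
move=> ab dH mH1.
have -> : m * (b ^+ 2 - a ^+ 2) / 2 = m / 2 * b ^+ 2 - m / 2 * a ^+ 2 by ring.
apply: (@deriv_le_le _ H H1 (fun t => m / 2 * t ^+ 2) (fun t => m * t)) => // t tab.
by der; field.
Qed.

Lemma radial_quotient_le k (D : set R) (H H1 H2 W W1 W2 G : R -> R) (a b : R) :
  radial_system k D H H1 H2 W W1 W2 G -> 0 < a -> a <= b ->
  (forall t, a <= t <= b -> D t) ->
  (forall t, a < t < b -> radial_defect k H1 W t <= 0) ->
  H1 b / b <= H1 a / a.
Proof.
move=> sys a0 ab Dab def0; rewrite -lerN2.
apply: (@ge0_deriv_le _ (fun t => - (H1 t * t^-1))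
  (fun t => - (radial_defect k H1 W t * t ^- k.+4))) => // t tab.
  by apply: deriv_opp; apply: (radial_quotient_deriv sys); [exact: Dab|lra].
rewrite oppr_ge0 mulr_le0_ge0 ?def0 // invr_ge0 exprn_ge0 //; lra.
Qed.

(* [G >= 0] makes [H] a concave function of [t ^+ 2] on [0, 2r]. *)
Lemma radial_center_le k (H H1 H2 W W1 W2 G : R -> R) (r : R) : 0 < r ->
  radial_system k [set t | 0 <= t <= 2 * r] H H1 H2 W W1 W2 G ->
  (forall t, 0 <= t <= 2 * r -> 0 <= G t) -> 0 <= H (2 * r) ->
  3 * H 0 <= 4 * H r.
Proof.
move=> r0 sys G0 H2r.
have Q0 t : 0 <= t <= 2 * r -> radial_flux k W1 t <= 0.
  move=> /andP[t0 tr].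
  have := @ge0_deriv_le _ (fun x => - radial_flux k W1 x)
    (fun x => x ^+ k.+2 * G x) 0 t t0.
  have -> : radial_flux k W1 0 = 0 by rewrite /radial_flux expr0n mul0r.
  rewrite oppr0 oppr_ge0; apply.
    move=> x xt; rewrite -[x ^+ k.+2 * G x]opprK.
    by apply: deriv_opp; apply: (radial_flux_deriv2 sys) => /=; lra.
  by move=> x xt; rewrite mulr_ge0 ?exprn_ge0 ?G0; lra.
have Z0 t : 0 <= t <= 2 * r -> radial_defect k H1 W t <= 0.
  move=> /andP[t0 tr].
  have := @ge0_deriv_le _ (fun x => - (radial_defect k H1 W x))
    (fun x => - (x * radial_flux k W1 x)) 0 t t0.
  have -> : radial_defect k H1 W 0 = 0.
    by rewrite /radial_defect /radial_flux !expr0n /= !mul0r mulr0 subrr.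
  rewrite oppr0 oppr_ge0; apply.
    by move=> x xt; apply: deriv_opp; apply: (radial_defect_deriv sys) => /=; lra.
  by move=> x xt; rewrite oppr_ge0 mulr_ge0_le0 ?Q0; lra.
have quot a b : 0 < a -> a <= b -> b <= 2 * r -> H1 b / b <= H1 a / a.
  move=> a0 ab br; apply: (radial_quotient_le sys) => // t tab /=; first lra.
  by apply: Z0; lra.
(* Twice the slope at [r] in the variable [t^2]: it bounds the slope from below on [[0, r]] and from
   above on [[r, 2 r]]. The second interval is three times as long in [t^2], so
   [H (2 r) - H r <= 3 (H r - H 0)]. *)
pose m := H1 r / r.
have dH t : 0 <= t <= 2 * r -> is_derive t 1 H (H1 t) by move=> /sys[[]].
have lo : m * (r ^+ 2 - 0 ^+ 2) / 2 <= H r - H 0.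
  apply: (@slope_ge_increment H H1) => [|t tr|t tr]; first exact: ltW.
    by apply: dH; lra.
  by rewrite -ler_pdivlMr; [apply: quot|]; lra.
have hi : H (2 * r) - H r <= m * ((2 * r) ^+ 2 - r ^+ 2) / 2.
  apply: (@slope_le_increment H H1) => [|t tr|t tr]; first lra.
    by apply: dH; lra.
  by rewrite -ler_pdivrMr; [apply: quot|]; lra.
by lra.
Qed.
End RadialConvexity.

(** * Growth forced by differential inequalities *)

Section Growth.
Context {R : realType}.
Implicit Types (F f : R -> R) (a b c M t : R).

Lemma deriv_le_neg_unbounded F f a c M : 0 < c ->
  (forall t, a <= t -> is_derive t 1 F (f t)) ->
  (forall t, a < t -> f t <= - c) ->
  exists2 T, a <= T & forall t, T <= t -> F t <= - M.
Proof.
move=> c0 dF fc; exists (a + Num.max 0 ((F a + M) / c)).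
  by rewrite lerDl le_max lexx.
move=> t tT; have at_ : a <= t.
  by apply: le_trans tT; rewrite lerDl le_max lexx.
have : F t - F a <= (- c * t) - (- c * a).
  apply: (@deriv_le_le _ F f (fun t => - c * t) (fun=> - c)) => //.
  - by move=> x /andP[ax _]; exact: dF.
  - by move=> x _; der; ring.
  - by move=> x /andP[ax _]; exact: fc.
have : (F a + M) / c <= t - a.
  have : Num.max 0 ((F a + M) / c) <= t - a by lra.
  by rewrite ge_max => /andP[].
rewrite ler_pdivrMr//; nra.
Qed.

Lemma ln_ge_eventually M : exists2 T, 1 <= T & forall t, T <= t -> M <= ln t.
Proof.
exists (Num.max 1 (expR M)); first by rewrite le_max lexx.
move=> t; rewrite ge_max => /andP[t1 tM].
by rewrite -[M]expRK ler_ln ?posrE ?expR_gt0//; lra.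
Qed.

Lemma deriv_le_neg_inv_unbounded F f a c M : 0 < a -> 0 < c ->
  (forall t, a <= t -> is_derive t 1 F (f t)) ->
  (forall t, a < t -> f t <= - (c / t)) ->
  exists2 T, a <= T & forall t, T <= t -> F t <= - M.
Proof.
move=> a0 c0 dF fc.
have [T1 T11 hT1] := ln_ge_eventually ((F a + M) / c + ln a).
exists (Num.max a T1); first by rewrite le_max lexx.
move=> t; rewrite ge_max => /andP[ta tT].
have : F t - F a <= - c * ln t - (- c * ln a).
  apply: (@deriv_le_le _ F f (fun t => - c * ln t) (fun t => - (c / t))) => //.
  - by move=> x /andP[ax _]; exact: dF.
  - by move=> x xa; der; [lra|ring].
  - by move=> x /andP[ax _]; exact: fc.
have : (F a + M) / c <= ln t - ln a by have := hT1 t tT; lra.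
rewrite ler_pdivrMr//; nra.
Qed.

(** Replaces integration to infinity: when the sign of [F (2 * t)] is known, it bounds [F t] below
    by [t * m]. *)
Lemma dyadic_decrease F f t m : 0 <= t ->
  (forall x, t <= x <= 2 * t -> is_derive x 1 F (f x)) ->
  (forall x, t < x < 2 * t -> f x <= - m) -> F (2 * t) + t * m <= F t.
Proof.
move=> t0 dF fm.
have : F (2 * t) - F t <= - m * (2 * t) - (- m * t).
  apply: (@deriv_le_le _ F f (fun t => - m * t) (fun=> - m)) => //; first lra.
  by move=> x _; der; ring.
lra.
Qed.
End Growth.

(** * Nonexistence for the radial differential inequalities *)

Section RadialNonexistence.
Context {R : realType} {k : nat} {r0 p : R} {V V1 V2 W W1 W2 G : R -> R}.
Hypotheses (r0_pos : 0 < r0) (one_lt_p : 1 < p).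
Hypothesis sys : radial_system k [set t | r0 < t] V V1 V2 W W1 W2 G.
Hypothesis V_gt0 : forall t, r0 < t -> 0 < V t.
Hypothesis G_ge0 : forall t, r0 < t -> 0 <= G t.
(** What the nonlinearity contributes while [V] stays away from 0. The ratio [3 / 2] is [6 / 4]: the
    averaging ring has outer radius 6, and a value of [v] at distance [4 s] will be compared with
    [V s]. *)
Hypothesis G_doubling : forall c0 C1 C2 T, r0 < T -> 0 < c0 ->
  (forall t, T <= t -> c0 <= V t /\ V t <= C2 * t ^+ 2) ->
  (forall s t, T <= t -> T <= s -> s <= 3 / 2 * t -> V s <= C1 * V t) ->
  exists2 c, 0 < c & exists2 T', r0 < T' &
    forall t, T' <= t -> c <= t ^+ 2 * G t.
(** What the growth of [f] at 0 contributes. The weights are [t^(n-2)] and [t^(n+2)]; the variable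
    [S] allows any positive lower bound of [t^(n-2) V] to be inserted. *)
Hypothesis G_bounded : forall C T, r0 < T -> (forall t, T <= t -> V t <= C) ->
  exists2 c, 0 < c & exists2 T', r0 < T' &
    forall t S, T' <= t -> 0 < S -> S <= t ^+ k.+1 * V t ->
    c * S `^ p <= t ^+ k.+4.+1 * G t.

Let dV t : r0 < t -> is_derive t 1 V (V1 t). Proof. by case/sys => -[]. Qed.
Let dW t : r0 < t -> is_derive t 1 W (W1 t). Proof. by case/sys => _ []. Qed.
Let dP t : r0 < t -> is_derive t 1 (radial_flux k V1) (t ^+ k.+2 * W t).
Proof. exact: (radial_flux_deriv sys). Qed.
Let dQ t : r0 < t -> is_derive t 1 (radial_flux k W1) (- (t ^+ k.+2 * G t)).
Proof. exact: (radial_flux_deriv2 sys). Qed.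
Let dZ t : r0 < t ->
  is_derive t 1 (radial_defect k V1 W) (t * radial_flux k W1 t).
Proof. exact: (radial_defect_deriv sys). Qed.

Lemma radial_flux2_noninc a b : r0 < a -> a <= b ->
  radial_flux k W1 b <= radial_flux k W1 a.
Proof.
have r0_gt0 := r0_pos; move=> ra ab; rewrite -lerN2.
apply: (@ge0_deriv_le _ (fun t => - radial_flux k W1 t) (fun t => t ^+ k.+2 * G t)) => // t tab.
  by rewrite -[t ^+ _ * _]opprK; apply: deriv_opp; apply: dQ; lra.
by rewrite mulr_ge0 ?exprn_ge0 ?G_ge0//; lra.
Qed.

(** The flux of [W1] has derivative at most [- c t^(n-3)], so it is at most [A - c1 t^(n-2)] with
    [c1 = c / (n - 2)]. Half of the main term absorbs the constant [A]; dividing by [t^(n-1)] leaves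
    [1 / t]. *)
Lemma W1_le_neg_inv c T : 0 < c -> r0 < T ->
  (forall t, T <= t -> c <= t ^+ 2 * G t) ->
  exists2 c', 0 < c' & exists2 T', r0 < T' &
    forall t, T' <= t -> W1 t <= - (c' / t).
Proof.
have r0_gt0 := r0_pos; move=> c0 rT GT.
have [c1 c1E] : exists c1, c1 = c / k.+1%:R by eexists.
have c10 : 0 < c1 by rewrite c1E divr_gt0.
have [A AE] : exists A, A = radial_flux k W1 T + c1 * T ^+ k.+1 by eexists.
exists (c1 / 2); first by rewrite divr_gt0.
exists (Num.max (Num.max T 1) (2 * A / c1)).
  by rewrite !lt_max rT.
move=> t; rewrite !ge_max => /andP[/andP[tT t1] tA].
have t0 : 0 < t by lra.
have QA : radial_flux k W1 t - radial_flux k W1 T <= - c1 * t ^+ k.+1 - (- c1 * T ^+ k.+1).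
  apply: (@deriv_le_le _ (radial_flux k W1) (fun t => - (t ^+ k.+2 * G t))
    (fun t => - c1 * t ^+ k.+1) (fun t => - (c * t ^+ k))) => //.
  - by move=> x xT; apply: dQ; lra.
  - by move=> x xT; der; rewrite c1E /=; field; rewrite -(natrD _ 1) pnatr_eq0.
  - move=> x /andP[xT _]; rewrite lerN2 -addn2 exprD -mulrA [c * _]mulrC.
    by rewrite ler_pM2l ?exprn_gt0 ?GT ?ltW//; lra.
have le1 : t <= t ^+ k.+1 by rewrite exprS ler_peMr ?exprn_ege1//; lra.
have Ac : 2 * A <= c1 * t ^+ k.+1.
  apply: (@le_trans _ _ (c1 * t)); last by rewrite ler_pM2l.
  by rewrite [c1 * t]mulrC -ler_pdivrMr.
have Qt : radial_flux k W1 t <= - (c1 / 2) * t ^+ k.+1 by lra.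
have tk : 0 < t ^+ k.+2 by rewrite exprn_gt0.
rewrite -(ler_pM2l tk); apply: le_trans Qt _.
by rewrite le_eqVlt; apply/orP; left; apply/eqP; rewrite [t ^+ k.+2]exprS; field; lra.
Qed.

(** Negativity persists, because the flux is nonincreasing, and drives the defect below 0. From then
    on [V1 t / t] is nonincreasing, and this one fact yields the sign of [V1], the quadratic bound
    and the doubling bound. Then [W] tends to minus infinity and pulls the flux of [V1] below 0. *)
Lemma W1_ge0 t1 : r0 < t1 -> 0 <= W1 t1.
Proof.
have r0_gt0 := r0_pos; move=> rt1; rewrite leNgt; apply/negP => W1t.
have [c cE] : exists c, c = - radial_flux k W1 t1 by eexists.
have c0 : 0 < c.
  by rewrite cE /radial_flux oppr_gt0 pmulr_rlt0// exprn_gt0//; lra.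
have [t2 t12 Z2] : exists2 T, t1 <= T & forall t, T <= t -> (radial_defect k V1 W) t <= - 0.
  apply: (@deriv_le_neg_unbounded _ (radial_defect k V1 W) (fun t => t * radial_flux k W1 t)
    t1 (t1 * c)) => //.
  - by rewrite mulr_gt0//; lra.
  - by move=> x x1; apply: dZ; lra.
  - move=> x x1; have := radial_flux2_noninc rt1 (ltW x1); nra.
have r2 : r0 < t2 by lra.
have quot a b : t2 <= a -> a <= b -> V1 b / b <= V1 a / a.
  move=> a2 ab; apply: (radial_quotient_le sys) => //; first lra.
    by move=> x xab /=; lra.
  by move=> x xab; rewrite -oppr0; apply: Z2; lra.
(* A negative [V1 a] would persist: for [x >= a] the quotient bound gives [V1 x <= V1 a], and [V]
   would cease to be positive. *)
have V1ge0 a : t2 <= a -> 0 <= V1 a.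
  move=> a2; rewrite leNgt; apply/negP => V1a.
  have [|||T aT VT] := @deriv_le_neg_unbounded _ V V1 a (- V1 a) 0; first lra.
  - by move=> x xa; apply: dV; lra.
  - move=> x xa; rewrite opprK; have := quot a x a2 (ltW xa).
    rewrite ler_pdivrMr; last lra.
    move=> h; apply: le_trans h _.
    rewrite -mulrA ger_nMr // ler_pdivlMl; lra.
  have := VT T (lexx _); have := @V_gt0 T; lra.
have Vmono a b : t2 <= a -> a <= b -> V a <= V b.
  move=> a2 ab; apply: (@ge0_deriv_le _ V V1) => // x xab.
    by apply: dV; lra.
  by apply: V1ge0; lra.
have [m mE] : exists m, m = V1 t2 / t2 by eexists.
have m0 : 0 <= m by rewrite mE divr_ge0 ?V1ge0//; lra.
have V20 := V_gt0 r2.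
have inc_le a b : t2 <= a -> a <= b ->
    V b - V a <= V1 a / a * (b ^+ 2 - a ^+ 2) / 2.
  move=> a2 ab; apply: (@slope_le_increment _ V V1) => // x xab.
    by apply: dV; lra.
  by rewrite -ler_pdivrMr; [apply: quot|]; lra.
have [||||c' c'0 [T rT GT]] := @G_doubling (V t2) 3 (V t2 / t2 ^+ 2 + m) (2 * t2).
- by lra.
- exact: V20.
- move=> t tt; split; first by apply: Vmono; lra.
  have := inc_le t2 t (lexx _) ltac:(lra).
  rewrite -mE.
  have : V t2 <= V t2 / t2 ^+ 2 * t ^+ 2.
    rewrite -mulrA ler_peMr ?(ltW V20)// ler_pdivlMl ?exprn_gt0 ?mulr1//; last lra.
    rewrite lerXn2r ?nnegrE//; lra.
  by have := sqr_ge0 t; have := sqr_ge0 t2; nra.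
(* With [d = V1 t / t], the increment from [t] to [s] is at most [5/8 d t^2] and that from [t2] to
   [t] at least [3/8 d t^2], as [t >= 2 t2]. Hence [V s <= 8/3 V t], and 3 suffices. *)
- move=> s t tt ss st; have [sle|tle] := leP s t.
    have := Vmono s t ltac:(lra) sle; have := V_gt0 (t := t) ltac:(lra); lra.
  have up := inc_le t s ltac:(lra) (ltW tle).
  have lo : V1 t / t * (t ^+ 2 - t2 ^+ 2) / 2 <= V t - V t2.
    apply: (@slope_ge_increment _ V V1) => [|x xt|x xt]; first lra.
      by apply: dV; lra.
    by rewrite -ler_pdivlMr; [apply: quot|]; lra.
  have D0 : 0 <= V1 t / t by rewrite divr_ge0 ?V1ge0//; lra.
  move: (V1 t / t) D0 up lo => d D0 up lo.
  have e1 : s ^+ 2 - t ^+ 2 <= 5 / 4 * t ^+ 2 by nra.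
  have e2 : 3 / 4 * t ^+ 2 <= t ^+ 2 - t2 ^+ 2 by nra.
  have := ler_wpM2l D0 e1; have := ler_wpM2l D0 e2.
  have : 0 <= d * t ^+ 2 by rewrite mulr_ge0 ?sqr_ge0.
  lra.
have [c1 c10 [T1 rT1 WT1]] := W1_le_neg_inv c'0 rT GT.
have [||||T2 T12 WT2] := @deriv_le_neg_inv_unbounded _ W W1 (Num.max T1 1) c1 1.
- by rewrite lt_max ltr01 orbT.
- by [].
- by move=> x; rewrite ge_max => /andP[? ?]; apply: dW; lra.
- by move=> x; rewrite gt_max => /andP[? ?]; apply: WT1; lra.
move: T12; rewrite ge_max => /andP[T12 T21].
have [T3 T32 T3t] : exists2 T3, T2 <= T3 & t2 <= T3.
  by exists (Num.max T2 t2); rewrite le_max lexx ?orbT.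
have [||T4 T34 PT4] := @deriv_le_neg_unbounded _ (radial_flux k V1)
  (fun t => t ^+ k.+2 * W t) T3 1 1 ltr01.
- by move=> x xT; apply: dP; lra.
- move=> x xT; have W1x := WT2 x ltac:(lra).
  have : 1 <= x ^+ k.+2 by apply: exprn_ege1; lra.
  nra.
have := PT4 T4 (lexx _); rewrite /radial_flux => h.
have : 0 <= T4 ^+ k.+2 * V1 T4 by rewrite mulr_ge0 ?exprn_ge0 ?V1ge0//; lra.
lra.
Qed.

(** A positive value of [W] persists since [W1 >= 0], while [W] stays bounded. So [V1] lies between
    two multiples of [t] and [V] between two multiples of [t^2]; such a [V] is doubling, and the
    resulting bound on [G] makes [W1] negative. *)
Lemma W_le0 t1 : r0 < t1 -> W t1 <= 0.
Proof.
have r0_gt0 := r0_pos; move=> rt1; rewrite leNgt; apply/negP => W0.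
have [q qE] : exists q, q = radial_flux k W1 t1 by eexists.
have q0 : 0 <= q by rewrite qE /radial_flux mulr_ge0 ?exprn_ge0 ?W1_ge0//; lra.
have Wmono t : t1 <= t -> W t1 <= W t.
  move=> t1t; apply: (@ge0_deriv_le _ W W1) => // x xt; first by apply: dW; lra.
  by apply: W1_ge0; lra.
have [T0 T01 T0t] : exists2 T0, 1 <= T0 & t1 <= T0.
  by exists (Num.max 1 t1); rewrite le_max lexx ?orbT.
have k0 : 0 < k.+3%:R :> R by rewrite ltr0n.
have expt (t : R) : 1 <= t -> t <= t ^+ k.+3.
  by move=> tt; rewrite exprS ler_peMr ?exprn_ege1//; lra.
have powd (m x : R) : is_derive x 1 (fun t => m / k.+3%:R * t ^+ k.+3) (m * x ^+ k.+2).
  by der; rewrite /=; field; rewrite -(natrD _ 3) pnatr_eq0.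
(* The flux of [W1] is at most [q], and [n >= 3], [t >= 1] weaken this to [W1 <= q / t^2], which is
   integrable at infinity. *)
have [B B0 WB] : exists2 B, 0 < B & forall t, T0 <= t -> W t <= B.
  exists (`|W T0| + q + 1); first by have := normr_ge0 (W T0); lra.
  move=> t tt.
  have : W t - W T0 <= - q * t^-1 - (- q * T0^-1).
    apply: (@deriv_le_le _ W W1 (fun t => - q * t^-1) (fun t => q / t ^+ 2)) => //.
    - by move=> x xt; apply: dW; lra.
    - by move=> x xt; der; [rewrite gt_eqF//; lra|field; rewrite gt_eqF//; lra].
    - move=> x xt; rewrite ler_pdivlMr ?exprn_gt0//; last lra.
      have := @radial_flux2_noninc t1 x rt1 ltac:(lra); rewrite -qE.
      apply: le_trans; rewrite /radial_flux [W1 x * _]mulrC ler_wpM2r ?W1_ge0//; first lra.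
      by rewrite ler_weXn2l//; lra.
  have : 0 <= q * t^-1 by rewrite mulr_ge0 ?invr_ge0//; lra.
  have : q * T0^-1 <= q by rewrite ler_piMr// invf_le1//; lra.
  have := ler_norm (W T0); lra.
have [M M0 [T1 T10 V1M]] : exists2 M, 0 < M &
    exists2 T1, T0 <= T1 & forall t, T1 <= t -> V1 t <= M * t.
  have n0 := normr_ge0 (radial_flux k V1 T0).
  have [e eE] : exists e, e = B / k.+3%:R by eexists.
  have e0 : 0 < e by rewrite eE divr_gt0.
  exists (`|radial_flux k V1 T0| + e); first by rewrite ltr_wpDl.
  exists T0 => // t tt.
  have : radial_flux k V1 t - radial_flux k V1 T0 <=
      e * t ^+ k.+3 - e * T0 ^+ k.+3.
    rewrite eE.
    apply: (@deriv_le_le _ (radial_flux k V1) (fun t => t ^+ k.+2 * W t)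
      (fun t => B / k.+3%:R * t ^+ k.+3) (fun t => B * t ^+ k.+2)) => //.
    - by move=> x xt; apply: dP; lra.
    - by move=> x xt; rewrite mulrC ler_wpM2r ?exprn_ge0 ?WB//; lra.
  have : 0 <= e * T0 ^+ k.+3 by rewrite mulr_ge0 ?exprn_ge0//; lra.
  have : radial_flux k V1 T0 <= `|radial_flux k V1 T0| * t ^+ k.+3.
    apply: le_trans (ler_norm _) _; rewrite ler_peMr// exprn_ege1//; lra.
  move=> h1 h2 h3.
  have tk : 0 < t ^+ k.+2 by rewrite exprn_gt0//; lra.
  rewrite -(ler_pM2l tk) -/(radial_flux k V1 t).
  rewrite (_ : _ * (_ * t) = (`|radial_flux k V1 T0| + e) * t ^+ k.+3); first lra.
  by rewrite [t ^+ k.+3]exprS; ring.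
have [m m0 [T2 T20 V1m]] : exists2 m, 0 < m &
    exists2 T2, T1 <= T2 & forall t, T2 <= t -> m * t <= V1 t.
  have [d dE] : exists d, d = W t1 / k.+3%:R by eexists.
  have d0 : 0 < d by rewrite dE divr_gt0.
  have [A AE] : exists A, A = d * T0 ^+ k.+3 - radial_flux k V1 T0 by eexists.
  exists (d / 2); first by rewrite divr_gt0.
  exists (Num.max T1 (2 * A / d)); first by rewrite le_max lexx.
  move=> t; rewrite ge_max ler_pdivrMr// => /andP[tT tA].
  have : d * t ^+ k.+3 - d * T0 ^+ k.+3 <= radial_flux k V1 t - radial_flux k V1 T0.
    rewrite dE.
    apply: (@deriv_le_le _ (fun t => W t1 / k.+3%:R * t ^+ k.+3)
      (fun t => W t1 * t ^+ k.+2) (radial_flux k V1) (fun t => t ^+ k.+2 * W t)) => //.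
    - lra.
    - by move=> x xt; apply: dP; lra.
    - by move=> x xt; rewrite mulrC ler_wpM2l ?exprn_ge0 ?Wmono//; lra.
  have tk : 0 < t ^+ k.+2 by rewrite exprn_gt0//; lra.
  have h1 := expt t ltac:(lra); have h2 : d * t <= d * t ^+ k.+3 by rewrite ler_pM2l.
  move=> h3; rewrite -(ler_pM2l tk) -/(radial_flux k V1 t).
  rewrite (_ : _ * (_ * t) = d / 2 * t ^+ k.+3); first lra.
  by rewrite [t ^+ k.+3]exprS; ring.
have dVx a b : T2 <= a -> a <= b -> forall t, a <= t <= b -> is_derive t 1 V (V1 t).
  by move=> ? ? t tab; apply: dV; lra.
have up t : T2 <= t -> V t <= (V T2 + M) * t ^+ 2.
  move=> tt; have := @slope_le_increment _ V V1 M T2 t tt (dVx T2 t (lexx _) tt).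
  have h x : T2 < x < t -> V1 x <= M * x by move=> xt; apply: V1M; lra.
  move=> /(_ h); have := @V_gt0 T2 ltac:(lra) => V20.
  have : V T2 <= V T2 * t ^+ 2 by rewrite ler_peMr ?exprn_ege1//; lra.
  have := mulr_ge0 (ltW M0) (sqr_ge0 T2); have := mulr_ge0 (ltW M0) (sqr_ge0 t).
  lra.
have lo t : 2 * T2 <= t -> m / 4 * t ^+ 2 <= V t.
  move=> tt.
  have := @slope_ge_increment _ V V1 m T2 t ltac:(lra) (dVx T2 t (lexx _) ltac:(lra)).
  have h x : T2 < x < t -> m * x <= V1 x by move=> xt; apply: V1m; lra.
  move=> /(_ h); have := @V_gt0 T2 ltac:(lra) => V20.
  have h2 : m * (t ^+ 2 / 2) <= m * (t ^+ 2 - T2 ^+ 2).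
    by rewrite ler_pM2l//; nra.
  lra.
(* With [C = V T2 + M], the doubling constant comes from [V s <= C s^2 <= 9/4 C t^2] and
   [m / 4 t^2 <= V t]. *)
have [||||c c0 [T rT GT]] := @G_doubling (m / 4) ((V T2 + M) * 9 / m) (V T2 + M) (2 * T2).
- lra.
- lra.
- move=> t tt; split; last by apply: up; lra.
  apply: le_trans (lo t tt); rewrite ler_peMr ?exprn_ege1//; lra.
- move=> s t tt ss st; have := up s ltac:(lra).
  have V20 := @V_gt0 T2 ltac:(lra).
  have C0 : 0 < V T2 + M by lra.
  have h : s ^+ 2 <= 9 / 4 * t ^+ 2 by nra.
  move: C0 (lo t tt) => /[swap]; move: (V T2 + M) => C h1 C0 h2.
  have h3 : C * s ^+ 2 <= C * 9 / m * (m / 4 * t ^+ 2).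
    rewrite (_ : _ * (_ * t ^+ 2) = C * (9 / 4 * t ^+ 2)); last by field; lra.
    by rewrite ler_pM2l.
  apply: le_trans h2 _; apply: le_trans h3 _; rewrite ler_wpM2l//.
  by rewrite divr_ge0// ?mulr_ge0//; lra.
have [c' c'0 [T' rT' h]] := W1_le_neg_inv c0 rT GT.
have := h T' (lexx _); have := W1_ge0 rT'.
have : 0 < c' / T' by rewrite divr_gt0//; lra.
lra.
Qed.

Lemma radial_flux_noninc a b : r0 < a -> a <= b ->
  radial_flux k V1 b <= radial_flux k V1 a.
Proof.
have r0_gt0 := r0_pos; move=> ra ab; rewrite -lerN2.
apply: (@ge0_deriv_le _ (fun t => - radial_flux k V1 t)
  (fun t => - (t ^+ k.+2 * W t))) => // t tab.
  by apply: deriv_opp; apply: dP; lra.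
by rewrite oppr_ge0 mulr_ge0_le0 ?exprn_ge0 ?W_le0//; lra.
Qed.

(** Otherwise [V] is nondecreasing, and bounded because [V1 <= q / t^2]. It then lies between
    positive constants, so it is doubling, and once more [W1] would become negative. *)
Lemma radial_flux_lt0 : exists2 t1, r0 < t1 & radial_flux k V1 t1 < 0.
Proof.
have r0_gt0 := r0_pos; apply: contrapT => noP.
have P0 t : r0 < t -> 0 <= V1 t.
  move=> rt; have t0 : 0 < t by lra.
  rewrite -(pmulr_rge0 _ (exprn_gt0 k.+2 t0)) leNgt; apply/negP => Pt.
  by apply: noP; exists t.
have [T rT T1] : exists2 T, r0 < T & 1 <= T.
  by exists (Num.max 1 (r0 + 1)); rewrite ?lt_max ?le_max ?lexx// ltrDl ltr01 orbT.
have [q qE] : exists q, q = radial_flux k V1 T by eexists.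
have q0 : 0 <= q by rewrite qE /radial_flux mulr_ge0 ?exprn_ge0 ?P0//; lra.
have Vmono t : T <= t -> V T <= V t.
  move=> tt; apply: (@ge0_deriv_le _ V V1) => // x xt; first by apply: dV; lra.
  by apply: P0; lra.
have VT0 := V_gt0 rT.
have Vbd t : T <= t -> V t <= V T + q.
  move=> tt.
  have : V t - V T <= - q * t^-1 - (- q * T^-1).
    apply: (@deriv_le_le _ V V1 (fun t => - q * t^-1) (fun t => q / t ^+ 2)) => //.
    - by move=> x xt; apply: dV; lra.
    - by move=> x xt; der; [rewrite gt_eqF//; lra|field; rewrite gt_eqF//; lra].
    - move=> x xt; rewrite ler_pdivlMr ?exprn_gt0//; last lra.
      have := @radial_flux_noninc T x rT ltac:(lra); rewrite -qE.
      apply: le_trans; rewrite /radial_flux [V1 x * _]mulrC ler_wpM2r ?P0//; first lra.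
      by rewrite ler_weXn2l//; lra.
  have : 0 <= q * t^-1 by rewrite mulr_ge0 ?invr_ge0//; lra.
  have : q * T^-1 <= q by rewrite ler_piMr// invf_le1//; lra.
  lra.
have [||c c0 [T' rT' GT]] := @G_doubling (V T) ((V T + q) / V T) (V T + q) T rT VT0.
- move=> t tt; split; first exact: Vmono.
  apply: le_trans (Vbd t tt) _; rewrite ler_peMr ?exprn_ege1//; lra.
- move=> s t tt ss st; apply: le_trans (Vbd s ss) _.
  by rewrite -mulrA ler_peMr ?ler_pdivlMl ?mulr1 ?Vmono//; lra.
have [c' c'0 [T2 rT2 h]] := W1_le_neg_inv c0 rT' GT.
have := h T2 (lexx _); have := W1_ge0 rT2.
have : 0 < c' / T2 by rewrite divr_gt0//; lra.
lra.
Qed.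

Theorem radial_nonexistence : False.
Proof.
have r0_gt0 := r0_pos; have p_gt1 := one_lt_p.
have [t1 rt1 Pt1] := radial_flux_lt0.
have [S SE] : exists S, S = fun t => - radial_flux k V1 t by eexists.
have dS t : r0 < t -> is_derive t 1 S (- (t ^+ k.+2 * W t)).
  by rewrite SE => rt; apply: deriv_opp; apply: dP.
have Smono a b : r0 < a -> a <= b -> S a <= S b.
  by move=> ra ab; rewrite SE lerN2 radial_flux_noninc.
have S0 t : t1 <= t -> 0 < S t.
  by move=> tt; apply: lt_le_trans (Smono _ _ rt1 tt); rewrite SE oppr_gt0.
have V1S t : r0 < t -> V1 t = - (S t * t ^- k.+2).
  move=> rt; rewrite SE mulNr opprK /radial_flux mulrAC divff ?mul1r//.
  by rewrite expf_neq0// gt_eqF//; lra.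
have powle (a x : R) j : 0 < a -> a < x < 2 * a -> (2 * a) ^- j <= x ^- j.
  move=> a0 xa; rewrite lef_pV2 ?posrE ?exprn_gt0//; try lra.
  by rewrite lerXn2r ?nnegrE//; lra.
(* This bound and the later [QS] and [WS] integrate over [[t, 2 t]] only: the term at [2 t] has a
   known sign ([V > 0], flux of [W1] nonnegative, [W <= 0]), and on the interval the nondecreasing
   [S] is at least [S t]. *)
have VS t : t1 <= t -> S t * 2 ^- k.+2 <= t ^+ k.+1 * V t.
  move=> tt; have t0 : 0 < t by lra.
  have h : V (2 * t) + t * (S t * (2 * t) ^- k.+2) <= V t.
    apply: (@dyadic_decrease _ V V1) => [|x xt|x xt]; first lra.
      by apply: dV; lra.
    rewrite V1S; last lra.
    rewrite lerN2; apply: ler_pM; rewrite ?invr_ge0 ?exprn_ge0 ?powle//; try lra.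
      by rewrite ltW// S0.
    by apply: Smono; lra.
  have V20 := V_gt0 (t := 2 * t) ltac:(lra).
  have {}h : t * (S t * (2 * t) ^- k.+2) <= V t by lra.
  have tk : 0 < t ^+ k.+1 by rewrite exprn_gt0.
  rewrite -(ler_pM2l tk) in h; apply: le_trans h.
  rewrite le_eqVlt; apply/orP; left; apply/eqP.
  rewrite exprMn [t ^+ k.+2]exprS; field.
  by rewrite !expf_neq0// ?gt_eqF//.
have Vmono t : t1 <= t -> V t <= V t1.
  move=> tt; rewrite -lerN2.
  apply: (@ge0_deriv_le _ (fun t => - V t) (fun t => - V1 t)) => // x xt.
    by apply: deriv_opp; apply: dV; lra.
  rewrite V1S ?opprK ?mulr_ge0 ?invr_ge0 ?exprn_ge0//; try lra.
  by rewrite ltW// S0//; lra.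
have [c c0 [T0 rT0 GS]] := G_bounded rt1 Vmono.
have [T T01 Tt1] : exists2 T, T0 <= T & t1 <= T.
  by exists (Num.max T0 t1); rewrite le_max lexx ?orbT.
have Sp0 t : T <= t -> 0 < S t `^ p by move=> tt; rewrite powR_gt0// S0//; lra.
have [c1 c10 GS1] : exists2 c1, 0 < c1 &
    forall t, T <= t -> c1 * S t `^ p <= t ^+ k.+4.+1 * G t.
  exists (c * (2 ^- k.+2) `^ p); first by rewrite mulr_gt0 ?powR_gt0 ?invr_gt0 ?exprn_gt0.
  move=> t tt; rewrite -mulrA -powRM ?invr_ge0 ?exprn_ge0//; last by rewrite ltW// S0//; lra.
  rewrite [_^-1 * _]mulrC.
  apply: GS; [lra|rewrite mulr_gt0 ?S0 ?invr_gt0 ?exprn_gt0//; lra|].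
  by apply: VS; lra.
have Spmono a b : T <= a -> a <= b -> S a `^ p <= S b `^ p.
  move=> aT ab; rewrite ge0_ler_powR ?nnegrE//; first lra.
  - by rewrite ltW// S0//; lra.
  - by rewrite ltW// S0//; lra.
  - by apply: Smono; lra.
have [c2 c20 QS] : exists2 c2, 0 < c2 &
    forall t, T <= t -> c2 * S t `^ p * t ^- 2 <= radial_flux k W1 t.
  exists (c1 * 2 ^- 3); first by rewrite mulr_gt0 ?invr_gt0 ?exprn_gt0.
  move=> t tt; have t0 : 0 < t by lra.
  have h : radial_flux k W1 (2 * t) + t * (c1 * S t `^ p * (2 * t) ^- 3) <= radial_flux k W1 t.
    apply: (@dyadic_decrease _ _ (fun t => - (t ^+ k.+2 * G t))) => [|x xt|x xt]; first lra.
      by apply: dQ; lra.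
    have x0 : 0 < x by lra.
    rewrite lerN2 (_ : x ^+ k.+2 * G x = (x ^+ k.+4.+1 * G x) * x ^- 3); last first.
      by rewrite -[in RHS](addn3 k.+2) exprD; field; rewrite gt_eqF.
    have Sp := Sp0 t tt.
    apply: ler_pM; rewrite ?mulr_ge0 ?invr_ge0 ?exprn_ge0 ?powle ?(ltW c10) ?(ltW Sp)//; try lra.
    apply: le_trans (GS1 x ltac:(lra)); rewrite ler_pM2l// Spmono//; lra.
  have : 0 <= radial_flux k W1 (2 * t).
    by rewrite /radial_flux mulr_ge0 ?exprn_ge0 ?W1_ge0//; lra.
  have : c1 * 2 ^- 3 * S t `^ p * t ^- 2 = t * (c1 * S t `^ p * (2 * t) ^- 3).
    by field; rewrite gt_eqF.
  lra.
have [c3 c30 WS] : exists2 c3, 0 < c3 &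
    forall t, T <= t -> c3 * S t `^ p / t <= - (t ^+ k.+2 * W t).
  exists (c2 * 2 ^- k.+4); first by rewrite mulr_gt0 ?invr_gt0 ?exprn_gt0.
  move=> t tt; have t0 : 0 < t by lra.
  have Sp := Sp0 t tt.
  have h : - W (2 * t) + t * (c2 * S t `^ p * (2 * t) ^- k.+4) <= - W t.
    apply: (@dyadic_decrease _ (fun t => - W t) (fun t => - W1 t)) => [|x xt|x xt]; first lra.
      by apply: deriv_opp; apply: dW; lra.
    have x0 : 0 < x by lra.
    rewrite lerN2 (_ : W1 x = (x ^+ 2 * radial_flux k W1 x) * x ^- k.+4); last first.
      by rewrite /radial_flux -[k.+4](addn2 k.+2) exprD; field; rewrite expf_neq0 gt_eqF.
    apply: ler_pM; rewrite ?mulr_ge0 ?invr_ge0 ?exprn_ge0 ?powle ?(ltW c20) ?(ltW Sp)//; try lra.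
    have := QS x ltac:(lra); rewrite ler_pdivrMr ?exprn_gt0// [radial_flux _ _ _ * _]mulrC => h.
    apply: le_trans h.
    by rewrite ler_pM2l// Spmono//; lra.
  have := W_le0 (t1 := 2 * t) ltac:(lra) => W2t.
  have {}h : t * (c2 * S t `^ p * (2 * t) ^- k.+4) <= - W t by lra.
  have tk : 0 < t ^+ k.+2 by rewrite exprn_gt0.
  rewrite -(ler_pM2l tk) mulrN in h; apply: le_trans h.
  rewrite le_eqVlt; apply/orP; left; apply/eqP.
  have tE : t ^+ k.+4 = t ^+ k.+2 * t ^+ 2 by rewrite -exprD addn2.
  rewrite exprMn tE; field.
  by rewrite !expf_neq0// ?gt_eqF//.
have p0 : 0 < (p - 1) * c3 by rewrite mulr_gt0// subr_gt0.
(* [WS] reads [S' >= c3 S^p / t]. Passing to [S^(1-p)] linearizes it: the derivative is at most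
   [- (p - 1) c3 / t], so this positive power would fall to 0 or below. *)
have [|t tt|t tt|T1 TT1 PT1] := @deriv_le_neg_inv_unbounded _ (fun t => S t `^ (1 - p))
    (fun t => (1 - p) * S t `^ (1 - p - 1) * - (t ^+ k.+2 * W t)) T ((p - 1) * c3) 0 _ p0.
- by lra.
- have := dS t ltac:(lra); have := is_derive1_powR (1 - p) (S0 t ltac:(lra)).
  exact: is_derive1_comp.
- have SpN : S t `^ (1 - p - 1) * S t `^ p = 1.
    have e : 1 - p - 1 + p = 0 by rewrite addrAC subrK subrr.
    have St : S t != 0 by rewrite gt_eqF// S0//; lra.
    by rewrite -powRD e ?powRr0// St implybT.
  have := WS t ltac:(lra); have : 0 < S t `^ (1 - p - 1) by rewrite powR_gt0// S0//; lra.
  move=> h; rewrite -(ler_pM2l h) => h2.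
  have e : S t `^ (1 - p - 1) * (c3 * S t `^ p / t) = c3 / t.
    rewrite -(mul1r (c3 / t)); move: SpN.
    by move: (S t `^ (1 - p - 1)) (S t `^ p) => a b <-; ring.
  have q1 : 0 < p - 1 by rewrite subr_gt0.
  rewrite e -(ler_pM2l q1) in h2; move: h2; lra.
have := PT1 T1 (lexx _); have : 0 < S T1 `^ (1 - p) by rewrite powR_gt0// S0//; lra.
lra.
Qed.
End RadialNonexistence.

(** * A positive functional annihilating derivatives *)

(** Compactness of [[- M, M]] gives a cluster point of the image filter; it is a limit because an
    ultrafilter contains every set or its complement. *)
Lemma ultra_cvg_bounded (R : realType) (F : set_system nat) (u : nat -> R) (M : R) :
  UltraFilter F -> (forall N, `|u N| <= M) -> exists l : R, u @ F --> l.
Proof.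
move=> FU uM.
have [] := @segment_compact R (- M) M (u @ F) _.
  by apply: (@filterS _ F _ setT) filterT => N _ /=; rewrite in_itv /= -ler_norml uM.
move=> l [_ cl]; exists l => A Al.
have [//|FA] := in_ultra_setVsetC (u @^-1` A) FU.
by have [x []] := cl (~` A) A FA Al.
Qed.

Section GridMean.
Context {R : realType} {n : nat}.
Implicit Types (B M e : R) (N : nat) (h g : 'rV[R]_n -> R) (y : 'rV[R]_n).

Definition box B : set 'rV[R]_n := [set y | forall i, - B <= y 0 i <= B].

Definition bounded_on (A : set 'rV[R]_n) h := exists M, forall y, A y -> `|h y| <= M.

(** Only lower corners of the cells occur: the index stops at [N] while the step is [2 B / (N + 1)],
    so no coordinate equals [B] when [B > 0]. A cyclic shift of the index is thus a translation
    except on the last layer, which it sends to [- B]. *)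
Definition grid_point B N (j : {ffun 'I_n -> 'I_N.+1}) : 'rV[R]_n :=
  \row_i (- B + 2 * B / N.+1%:R * (j i)%:R).

Definition grid_mean B h N : R :=
  (\sum_(j : {ffun 'I_n -> 'I_N.+1}) h (grid_point B j)) /
  #|{: {ffun 'I_n -> 'I_N.+1}}|%:R.

Lemma grid_card_gt0 N : 0 < #|{: {ffun 'I_n -> 'I_N.+1}}|%:R :> R.
Proof. by rewrite ltr0n; apply/card_gt0P; exists [ffun=> ord0]. Qed.

Lemma grid_point_box B N j : 0 <= B -> box B (@grid_point B N j).
Proof.
move=> B0 i; rewrite mxE.
have N0 : 0 < N.+1%:R :> R by rewrite ltr0n.
have jN : (j i)%:R <= N.+1%:R :> R by rewrite ler_nat ltnW.
have : 0 <= 2 * B / N.+1%:R * (j i)%:R by rewrite mulr_ge0 ?divr_ge0 ?mulr_ge0 ?ler0n.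
have : 2 * B / N.+1%:R * (j i)%:R <= 2 * B.
  by rewrite mulrAC ler_pdivrMr// ler_wpM2l// mulr_ge0.
by move: (_ * (j i)%:R) => x x1 x0; apply/andP; split; lra.
Qed.

Lemma grid_meanD B (a : R) h g N :
  grid_mean B (fun y => a * h y + g y) N = a * grid_mean B h N + grid_mean B g N.
Proof.
by rewrite /grid_mean big_split /= mulrDl; congr (_ + _); rewrite -mulr_sumr mulrA.
Qed.

Lemma grid_mean_le B h g N : 0 <= B -> (forall y, box B y -> h y <= g y) ->
  grid_mean B h N <= grid_mean B g N.
Proof.
move=> B0 hg; rewrite /grid_mean ler_wpM2r ?invr_ge0 ?ler0n//.
by apply: ler_sum => j _; apply/hg/grid_point_box.
Qed.

Lemma grid_mean_cst B (c : R) N : grid_mean B (fun=> c) N = c.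
Proof.
rewrite /grid_mean sumr_const -[c *+ _]mulr_natr mulfK//.
by rewrite gt_eqF// grid_card_gt0.
Qed.

Lemma grid_mean_bound B h M N : 0 <= B -> (forall y, box B y -> `|h y| <= M) ->
  `|grid_mean B h N| <= M.
Proof.
move=> B0 hM; rewrite ler_norml -[leLHS](grid_mean_cst B _ N).
rewrite -[X in _ && (_ <= X)](grid_mean_cst B _ N).
by apply/andP; split; apply: grid_mean_le => // y /hM; rewrite ler_norml => /andP[].
Qed.

(* The grid is invariant under the cyclic shift in direction [i]; the points
   where that shift is not a translation lie on the boundary slab, where [h]
   vanishes. *)
Lemma grid_mean_shift B h i N : 0 < B ->
  (forall y, y 0 i <= - B \/ B <= y 0 i -> h y = 0) ->
  grid_mean B (fun y => h (y + (2 * B / N.+1%:R) *: delta_mx 0 i)) N =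
  grid_mean B h N.
Proof.
move=> B0 h0; rewrite /grid_mean; congr (_ / _).
pose s (j : {ffun 'I_n -> 'I_N.+1}) : {ffun 'I_n -> 'I_N.+1} :=
  [ffun i' => if i' == i then ordS (j i') else j i'].
have s_inj : injective s.
  move=> j1 j2 /ffunP s12; apply/ffunP => i'; move: (s12 i'); rewrite !ffunE.
  by case: eqP => // _ /ordS_inj.
rewrite [RHS](reindex_inj s_inj); apply: eq_bigr => j _.
have N0 : N.+1%:R != 0 :> R by rewrite pnatr_eq0.
have [jN|jN] := ltnP (j i).+1 N.+1; last first.
  have jE : j i = N :> nat by apply/eqP; rewrite eqn_leq -ltnS ltn_ord -ltnS.
  rewrite !h0//.
  - by left; rewrite !mxE ffunE eqxx /= jE modnn mulr0 addr0.
  - right; rewrite !mxE !eqxx /= jE mulr1 le_eqVlt; apply/orP; left; apply/eqP.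
    by rewrite -addrA -[X in _ + (_ + X)]mulr1 -mulrDr natr1 divfK//; ring.
congr h; apply/rowP => i'; rewrite !mxE ffunE.
have [->|] := eqVneq i' i; last by rewrite mulr0 addr0.
by rewrite /= modn_small// mulr1 -addrA -[(j i).+1%:R]natr1 mulrDr mulr1.
Qed.

(** Discrete integration by parts: shift invariance makes the mean of the difference quotient
    vanish, so the mean of [dh] is only the mean of the approximation error. *)
Lemma grid_mean_diff_quotient B h dh i N (e : R) : 0 < B -> 0 <= e ->
  (forall y, y 0 i <= - B \/ B <= y 0 i -> h y = 0) ->
  (forall y, box B y ->
    `|h (y + (2 * B / N.+1%:R) *: delta_mx 0 i) - h y - 2 * B / N.+1%:R * dh y|
      <= e * (2 * B / N.+1%:R)) ->
  `|grid_mean B dh N| <= e.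
Proof.
move=> B0 e0 h0 hdh; set s := 2 * B / N.+1%:R in hdh *.
have s0 : 0 < s by rewrite divr_gt0 ?mulr_gt0// ltr0n.
have := grid_mean_bound N (ltW B0) hdh.
have -> : (fun y => h (y + s *: delta_mx 0 i) - h y - s * dh y) =
    (fun y => (- s) * dh y + ((-1) * h y + h (y + s *: delta_mx 0 i))).
  by apply/funext => y; ring.
rewrite !grid_meanD grid_mean_shift// mulN1r addNr addr0.
by rewrite normrM normrN (gtr0_norm s0) mulrC ler_pM2r.
Qed.

(** The integers [truncn a + 1, ..., truncn a + truncn L] all lie in the interval. *)
Lemma card_ord_interval (a L : R) N : 0 <= a -> 1 <= L -> a + L < N.+1%:R ->
  L - 1 <= #|[set j : 'I_N.+1 | a <= j%:R <= a + L]|%:R.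
Proof.
move=> a0 L1 aL; pose a1 := (Num.truncn a).+1; pose m := Num.truncn L.
have /andP[ta aS] := truncn_itv a0.
have /andP[tL LS] : (Num.truncn L)%:R <= L < (Num.truncn L).+1%:R by apply: truncn_itv; lra.
have jN (j : 'I_m) : (Num.truncn a + j.+1 < N.+1)%N.
  rewrite -(ltr_nat R) natrD; apply: le_lt_trans aL; rewrite lerD//.
  by apply: le_trans tL; rewrite ler_nat.
pose f (j : 'I_m) : 'I_N.+1 := Ordinal (jN j).
have f_inj : injective f.
  by move=> j1 j2 /(congr1 val) /= /addnI [] /val_inj.
have : (m <= #|[set j : 'I_N.+1 | (a <= j%:R <= a + L)%R]|)%N.
  rewrite -[m in (m <= _)%N]card_ord -(card_imset _ f_inj) subset_leq_card//.
  apply/fintype.subsetP => _ /imsetP[j _ ->]; rewrite inE /= natrD; apply/andP; split.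
    have : 1 <= j.+1%:R :> R by rewrite ler1n.
    by move: aS; rewrite -natr1; lra.
  rewrite lerD//; apply: le_trans tL; rewrite ler_nat; exact: ltn_ord.
rewrite -(ler_nat R); apply: le_trans.
by move: LS; rewrite -natr1 /m; lra.
Qed.

(** Counts grid points in a cube of half-width [eta]. In each direction it spans [L >= 2] grid
    steps, hence at least [L - 1 >= L / 2] indices, a proportion [eta / (2 B)]. The bound depends
    neither on [N] nor on the centre, so it survives the limit. *)
Lemma grid_mean_lower B (eta : R) h (c : 'rV[R]_n) N : 0 < B -> 0 < eta ->
  2 * B <= eta * N.+1%:R ->
  (forall i, - B <= c 0 i - eta /\ c 0 i + eta < B) ->
  (forall y, box B y -> 0 <= h y) ->
  (forall y, (forall i, `|y 0 i - c 0 i| <= eta) -> 1 <= h y) ->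
  (eta / (2 * B)) ^+ n <= grid_mean B h N.
Proof.
move=> B0 eta0 NB cB h0 h1.
have N0 : 0 < N.+1%:R :> R by rewrite ltr0n.
have [d dE] : exists d : R, d = 2 * B / N.+1%:R by eexists.
have d0 : 0 < d by rewrite dE divr_gt0 ?mulr_gt0.
have [L LE] : exists L, L = 2 * eta / d by eexists.
pose a i := (c 0 i - eta + B) / d.
pose S i := [set j : 'I_N.+1 | a i <= j%:R <= a i + L].
have L2 : 2 <= L.
  by rewrite LE ler_pdivlMr// dE mulrA ler_pdivrMr// -mulrA ler_pM2l.
have cardS i : L / 2 <= #|S i|%:R.
  have [c1 c2] := cB i; apply: (@le_trans _ _ (L - 1)).
    by clear -L2; lra.
  apply: card_ord_interval.
  - by rewrite divr_ge0 ?(ltW d0)//; clear -c1; lra.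
  - by apply: le_trans L2; rewrite ler1n.
  - rewrite /a LE -mulrDl ltr_pdivrMr// dE mulrCA divff ?gt_eqF// mulr1.
    by clear -c2; lra.
have cardE : #|{: {ffun 'I_n -> 'I_N.+1}}|%:R = N.+1%:R ^+ n :> R.
  by rewrite card_ffun !card_ord natrX.
rewrite /grid_mean cardE ler_pdivlMr ?exprn_gt0// -exprMn.
(* Expanding the product of sums of indicators gives a sum over all grid indices, in which only
   indices inside the cube contribute. *)
apply: (@le_trans _ _ (\prod_(i < n) \sum_(k < N.+1) (k \in S i)%:R)).
  rewrite -[X in _ ^+ X]card_ord -prodr_const; apply: ler_prod => i _.
  apply/andP; split; first by rewrite mulr_ge0 ?divr_ge0 ?mulr_ge0// ltW.
  have -> : \sum_(k < N.+1) (k \in S i)%:R = #|S i|%:R :> R.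
    by rewrite -sum1_card natr_sum [RHS]big_mkcond; apply: eq_bigr => k _; case: ifP.
  apply: le_trans (cardS i); rewrite le_eqVlt; apply/orP; left; apply/eqP.
  by rewrite LE dE; field; rewrite !gt_eqF.
rewrite bigA_distr_bigA; apply: ler_sum => j _.
have [/forallP jS|] := boolP [forall i, j i \in S i].
  rewrite big1 => [|i _]; last by rewrite jS.
  apply: h1 => i; have := jS i; rewrite inE => /andP[].
  rewrite mxE -dE /a LE -mulrDl ler_pdivrMr// ler_pdivlMr// mulrC ler_norml.
  by move: (d * _) => x ? ?; apply/andP; split; lra.
rewrite negb_forall => /existsP[i /negbTE ji].
by rewrite (bigD1 i)//= ji mul0r h0//; apply: grid_point_box; exact: ltW.
Qed.

(* The properties of the Lebesgue mean over the box that the argument uses. *)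
Definition box_mean B (I : ('rV[R]_n -> R) -> R) : Prop :=
  [/\ forall (a : R) h g, bounded_on (box B) h -> bounded_on (box B) g ->
        I (fun y => a * h y + g y) = a * I h + I g,
      forall h g, bounded_on (box B) h -> bounded_on (box B) g ->
        (forall y, box B y -> h y <= g y) -> I h <= I g,
      forall c : R, I (fun=> c) = c,
      forall h dh i, bounded_on (box B) dh ->
        (forall y, y 0 i <= - B \/ B <= y 0 i -> h y = 0) ->
        (forall e : R, 0 < e -> exists2 d : R, 0 < d & forall s y,
          0 < s < d -> box B y ->
          `|h (y + s *: delta_mx 0 i) - h y - s * dh y| <= e * s) ->
        I dh = 0 &
      forall eta : R, 0 < eta -> exists2 m : R, 0 < m & forall h (c : 'rV[R]_n),
        bounded_on (box B) h ->
        (forall i, - B <= c 0 i - eta /\ c 0 i + eta < B) ->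
        (forall y, box B y -> 0 <= h y) ->
        (forall y, (forall i, `|y 0 i - c 0 i| <= eta) -> 1 <= h y) ->
        m <= I h].

Lemma exists_box_mean B : 0 < B -> exists I, box_mean B I.
Proof.
move=> B0; have B0' := ltW B0.
have [F [FU oF]] := @ultraFilterLemma nat \oo _.
(* The limit is needed only for bounded [h]; otherwise the implication is vacuous and the value of
   [I h] is arbitrary. This is why boundedness accompanies every rule for [I]. *)
have lim_ex h : exists l : R, bounded_on (box B) h -> grid_mean B h @ F --> l.
  have [[M hM]|] := pselect (bounded_on (box B) h); last by exists 0.
  have [l ul] := ultra_cvg_bounded FU (fun N => grid_mean_bound N B0' hM).
  by exists l.
pose I h := projT1 (cid (lim_ex h)).
have Icvg h : bounded_on (box B) h -> grid_mean B h @ F --> I h := projT2 (cid (lim_ex h)).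
have FP : ProperFilter F by exact: ultra_proper.
have bD (a : R) h g : bounded_on (box B) h -> bounded_on (box B) g ->
    bounded_on (box B) (fun y => a * h y + g y).
  move=> [M hM] [M' gM]; exists (`|a| * M + M') => y By.
  rewrite (le_trans (ler_normD _ _))// lerD ?gM// normrM ler_wpM2l// hM//.
have bC (c : R) : bounded_on (box B) (fun=> c) by exists `|c|.
have near_oo (P : nat -> Prop) : (\forall N \near \oo, P N) -> \forall N \near F, P N.
  exact: oF.
have large (d : R) : 0 < d ->
    exists N0, forall N, (N0 <= N)%N -> 2 * B / N.+1%:R < d.
  move=> d0; exists (Num.truncn (2 * B / d)) => N N0.
  rewrite ltr_pdivrMr ?ltr0n// [d * _]mulrC -ltr_pdivrMr//.
  by apply: lt_le_trans (truncnS_gt _) _; rewrite ler_nat.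
exists I; split.
- move=> a h g bh bg; apply: (cvg_unique _ (Icvg _ (bD a h g bh bg))) => //=.
  rewrite (_ : grid_mean _ _ = fun N => a * grid_mean B h N + grid_mean B g N); last first.
    by apply/funext => N; rewrite grid_meanD.
  by apply: cvgD (Icvg _ bg); apply: cvgMr (Icvg _ bh).
- move=> h g bh bg hg; apply: ler_cvg_to (Icvg _ bh) (Icvg _ bg) _.
  by apply: nearW => N; apply: grid_mean_le.
- move=> c; apply: (cvg_unique _ (Icvg _ (bC c))) => //=.
  rewrite (_ : grid_mean _ _ = fun=> c); first exact: cvg_cst.
  by apply/funext => N; rewrite grid_mean_cst.
- move=> h dh i bdh h0 hdh; apply/eqP; rewrite -normr_le0; apply/ler_addgt0Pl => e e0.
  rewrite addr0; have [d d0 hd] := hdh e e0.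
  apply: (ler_cvg_to (cvg_norm (Icvg _ bdh)) (cvg_cst e)).
  apply: near_oo; have [N0 N0P] := large d d0; exists N0 => // N /= /N0P Nd.
  apply: (@grid_mean_diff_quotient B h dh i) => //; first exact: ltW.
  by move=> y By; apply: hd => //; rewrite Nd divr_gt0 ?mulr_gt0.
- move=> eta eta0; exists ((eta / (2 * B)) ^+ n).
    by rewrite exprn_gt0// divr_gt0// mulr_gt0.
  move=> h c bh cB h0 h1.
  apply: (ler_cvg_to (cvg_cst _) (Icvg _ bh)).
  apply: near_oo; have [N0 N0P] := large _ eta0; exists N0 => // N /= /N0P.
  rewrite ltr_pdivrMr ?ltr0n// => /ltW Nd.
  by apply: (@grid_mean_lower B eta h c).
Qed.
End GridMean.

(** * Continuously differentiable functions *)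

Section ContinuouslyDifferentiable.
Context {R : realType} {n : nat}.
Implicit Types (y z w : 'rV[R]_n) (u : 'rV[R]_n -> R) (du : 'I_n -> 'rV[R]_n -> R).
Implicit Types (U C D : set 'rV[R]_n).

Lemma coord_le_norm y i : `|y 0 i| <= `|y|.
Proof.
have /mapP[j Hj yE] : `|y 0 i| \in [seq `|y x.1 x.2| | x : 'I_1 * 'I_n].
  by apply/mapP; exists (ord0, i) => //=; rewrite mem_enum.
by rewrite yE [leRHS]/Num.norm /= mx_normrE; apply/bigmax_geP; right => /=; exists j.
Qed.

Lemma norm_le_coord y (M : R) : 0 <= M -> (forall i, `|y 0 i| <= M) -> `|y| <= M.
Proof.
move=> M0 yM; rewrite /Num.norm /= mx_normrE; apply/bigmax_leP; split => // -[i j] _ /=.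
by rewrite ord1.
Qed.

Lemma deriv_lineP u w e (s l : R) : is_derive (w + s *: e) e u l <->
  is_derive s 1 (fun t => u (w + t *: e)) l.
Proof.
have shiftE : (fun h : R => h^-1 *: (((fun t => u (w + t *: e)) \o shift s) (h *: 1) -
    u (w + s *: e))) =
    (fun h : R => h^-1 *: ((u \o shift (w + s *: e)) (h *: e) - u (w + s *: e))).
  apply/funext => h; congr (_ *: (u _ - _)).
  by rewrite /= [h *: 1]mulr1 scalerDl addrCA.
split=> -[du dl]; split.
- by rewrite /derivable shiftE.
- by rewrite /derive shiftE.
- by rewrite /derivable -shiftE.
- by rewrite /derive -shiftE.
Qed.

Lemma linear_increment (phi dphi : R -> R) (b m e : R) :
  (forall x : R, `|x| <= `|b| -> is_derive x 1 phi (dphi x)) ->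
  (forall x : R, `|x| <= `|b| -> `|dphi x - m| <= e) ->
  `|phi b - phi 0 - b * m| <= e * `|b|.
Proof.
move=> dp be.
have lip (a c : R) : a <= c -> `|a| <= `|b| -> `|c| <= `|b| ->
    `|phi c - phi a - (c - a) * m| <= e * (c - a).
  move=> ac ab cb.
  have inb (x : R) : a <= x <= c -> `|x| <= `|b|.
    move=> xac; rewrite ler_norml; move: ab cb; rewrite !ler_norml; lra.
  have dlin (t x : R) : is_derive x 1 (fun x => t * x) t by der; ring.
  have up : phi c - phi a <= (m + e) * c - (m + e) * a.
    apply: (@deriv_le_le _ phi dphi (fun x => (m + e) * x) (fun=> m + e)) => //.
    - by move=> x /inb; exact: dp.
    - move=> x xac; have /be : `|x| <= `|b| by apply: inb; lra.
      by rewrite ler_norml; lra.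
  have lo : (m - e) * c - (m - e) * a <= phi c - phi a.
    apply: (@deriv_le_le _ (fun x => (m - e) * x) (fun=> m - e) phi dphi) => //.
    - by move=> x /inb; exact: dp.
    - move=> x xac; have /be : `|x| <= `|b| by apply: inb; lra.
      by rewrite ler_norml; lra.
  by rewrite ler_norml; lra.
have [b0|b0] := leP 0 b.
  by have := lip 0 b b0; rewrite normr0 normr_ge0 !subr0 ger0_norm//; apply.
have := lip b 0 (ltW b0) (lexx _); rewrite normr0 sub0r => /(_ (normr_ge0 _)).
have -> : phi b - phi 0 - b * m = - (phi 0 - phi b - - b * m) by ring.
by rewrite normrN (ltr0_norm b0).
Qed.

(** The partial derivatives are carried as explicit data, so products, sums and compositions come
    with their formulas and may be continued further. *)
Definition C1_on U u du := forall y, U y -> {for y, continuous u} /\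
  forall i, is_derive y (delta_mx 0 i) u (du i y) /\ {for y, continuous (du i)}.

(** A Lebesgue-number principle. It supplies uniform radii, moduli of continuity and, read with
    [d^-1] as the bound, boundedness on compact sets. *)
Lemma compact_uniform C (P : R -> 'rV[R]_n -> Prop) : compact C ->
  (forall z, C z -> exists2 r : R, 0 < r &
    forall d z', 0 < d < r -> `|z' - z| < r -> P d z') ->
  exists2 d : R, 0 < d & forall z, C z -> P d z.
Proof.
move=> /compact_near_coveringP cC CP.
have [z /CP[r r0 rP]|r r0 rP] := cC _ (0^'+ : set_system R) P _.
  exists (ball z r, [set d | 0 < d < r]); last first.
    by move=> [z' d] [/= zz' dr]; apply: rP => //; rewrite distrC -ball_normE in zz' *.
  split=> /=; first exact: nbhsx_ballx.
  by near=> d; apply/andP; split; near: d; [exact: nbhs_right_gt|exact: nbhs_right_lt].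
exists (r / 2); first by rewrite divr_gt0.
apply: rP; last by rewrite divr_gt0.
by rewrite /ball /= sub0r normrN gtr0_norm ?divr_gt0// ltr_pdivrMr// ltr_pMr// ltr1n.
Unshelve. all: by end_near. Qed.

(** The usual proof that continuous partial derivatives give differentiability, with the modulus
    made uniform on [C] by compactness. Dividing [e] by [n + 1] rather than [n] covers [n = 0]. *)
Lemma C1_on_uniform U C u du (e : R) : open U -> compact C -> C `<=` U ->
  C1_on U u du -> 0 < e -> exists2 d : R, 0 < d & forall z, C z -> forall w, `|w| < d ->
  `|u (z + w) - u z - \sum_i w 0 i * du i z| <= e * `|w|.
Proof.
move=> oU cC CU uC1 e0.
have n0 : 0 < n.+1%:R :> R by rewrite ltr0n.
have [e1 e1E] : exists e1, e1 = e / n.+1%:R by eexists.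
have e10 : 0 < e1 by rewrite e1E divr_gt0.
have [|d d0 dP] := @compact_uniform C (fun d z => forall z', `|z' - z| < d ->
    U z' /\ forall i, `|du i z' - du i z| <= e1) cC.
  move=> z Cz; have Uz := CU z Cz.
  have : \forall z' \near z, U z' /\ forall i, `|du i z' - du i z| < e1 / 2.
    have nU : \forall z' \near z, U z' by apply: open_nbhs_nbhs; split.
    have ndu : \forall z' \near z, forall i, `|du i z' - du i z| < e1 / 2; last first.
      by apply: filterS2 nU ndu.
    apply: (@filter_forall _ _ (fun i => [set z' | `|du i z' - du i z| < e1 / 2]) (nbhs z)) => i.
    have [_ /(_ i)[_ /cvgrPdistC_lt]] := uC1 z Uz.
    by apply; exact: divr_gt0.
  move=> /nbhs_ballP[r /= r0 rP]; exists (r / 2); first exact: divr_gt0.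
  move=> d z1 /andP[d0 dr] z1z z2 z21.
  have [_ h1] : U z1 /\ forall i, `|du i z1 - du i z| < e1 / 2.
    by apply: rP; rewrite -ball_normE /= distrC; lra.
  have [U2 h2] : U z2 /\ forall i, `|du i z2 - du i z| < e1 / 2.
    apply: rP; rewrite -ball_normE /= distrC.
    by rewrite (le_lt_trans (ler_distD z1 _ _))// [ltRHS]splitr ltrD// (lt_trans z21).
  split => // i; rewrite (le_trans (ler_distD (du i z) _ _))// [leRHS]splitr.
  by rewrite lerD ?ltW// distrC.
exists d => // z Cz w wd.
(* A staircase from [z] to [z + w], changing one coordinate at a time; in the sup norm it never
   leaves the ball of radius [|w|] about [z]. *)
pose x (j : nat) : 'rV[R]_n := \row_i (z 0 i + if (i < j)%N then w 0 i else 0).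
have xn : x n = z + w by apply/rowP => i; rewrite !mxE ltn_ord.
have x0 : x 0%N = z by apply/rowP => i; rewrite !mxE addr0.
rewrite -xn -[in u z]x0 -(telescope_sumr (fun j => u (x j)) (leq0n n)) big_mkord -sumrB.
apply: le_trans (ler_norm_sum _ _ _) _.
have -> : e * `|w| = n.+1%:R * (e1 * `|w|) by rewrite e1E; field; rewrite gt_eqF.
apply: (@le_trans _ _ (\sum_(i < n) e1 * `|w|)); last first.
  rewrite sumr_const card_ord -[leLHS]mulr_natl ler_wpM2r ?ler_nat//.
  by rewrite mulr_ge0// ltW.
apply: ler_sum => i _.
apply: (@le_trans _ _ (e1 * `|w 0 i|)); last by rewrite ler_pM2l// coord_le_norm.
have xS : x i.+1 = x i + w 0 i *: delta_mx 0 i.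
  apply/rowP => j; rewrite !mxE eqxx /= ltnS -val_eqE /=.
  by case: ltngtP => [ji|ij|/val_inj->]; rewrite /= ?mulr0 ?mulr1 ?addr0.
have xt (t : R) : `|t| <= `|w 0 i| -> `|x i + t *: delta_mx 0 i - z| < d.
  move=> tw; apply: le_lt_trans wd; apply: norm_le_coord => // j; rewrite !mxE eqxx /=.
  have [->|ji] := eqVneq j i.
    rewrite ltnn ?eqxx addr0 mulr1 [z 0 i + _]addrC addrK.
    by apply: le_trans tw _; exact: coord_le_norm.
  rewrite mulr0 addr0 [z 0 j + _]addrC addrK; case: ifP => _; first exact: coord_le_norm.
  by rewrite normr0.
have := @linear_increment (fun t => u (x i + t *: delta_mx 0 i))
  (fun t => du i (x i + t *: delta_mx 0 i)) (w 0 i) (du i z) e1.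
rewrite scale0r addr0 -xS; apply.
- move=> t /xt /(dP z Cz)[Ut _]; apply/deriv_lineP.
  by have [_ /(_ i)[]] := uC1 _ Ut.
- by move=> t /xt /(dP z Cz)[_].
Unshelve. all: by end_near. Qed.

End ContinuouslyDifferentiable.

Lemma linear_approx_deriv (R : realType) (F : R -> R) (x l : R) :
  (forall e : R, 0 < e -> exists2 d : R, 0 < d &
     forall h, `|h| < d -> `|F (x + h) - F x - h * l| <= e * `|h|) ->
  is_derive x 1 F l.
Proof.
move=> Fl.
have cv : (fun h : R => h^-1 *: ((F \o shift x) (h *: 1) - F x)) @ 0^' --> l.
  apply/cvgrPdistC_lt => e e0.
  have [d d0 dP] := Fl (e / 2) ltac:(by rewrite divr_gt0).
  exists d => // h /=; rewrite sub0r normrN => hd h0.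
  have -> : h^-1 *: (F (h *: 1 + x) - F x) - l = h^-1 * (F (x + h) - F x - h * l).
    by rewrite /GRing.scale /= mulr1 [h + x]addrC [RHS]mulrBr mulKf.
  rewrite normrM normfV; apply: (@le_lt_trans _ _ (e / 2)).
    by rewrite mulrC ler_pdivrMr ?normr_gt0// dP.
  by rewrite ltr_pdivrMr// ltr_pMr// ltr1n.
split; first by apply/cvg_ex; exists l.
exact: (cvg_lim (@Rhausdorff R) cv).
Qed.

Section BoundedFunctions.
Context {R : realType} {n : nat}.
Implicit Types (A C D : set 'rV[R]_n) (g h : 'rV[R]_n -> R) (B : R).

Lemma shift_continuous (a : 'rV[R]_n) : continuous (fun z : 'rV[R]_n => z - a).
Proof.
by move=> z; apply: (@cvgB _ _ _ (nbhs z)); [exact: cvg_id|exact: cvg_cst].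
Qed.

Lemma affine_continuous (c a : 'rV[R]_n) (r : R) :
  continuous (fun z : 'rV[R]_n => c + r *: (z - a)).
Proof.
move=> z; apply: (@cvgD _ _ _ (nbhs z)); first exact: cvg_cst.
apply: (@cvgZl_tmp _ _ _ (nbhs z)); exact: shift_continuous.
Qed.

Lemma box_compact B : compact (@box R n B).
Proof.
have -> : @box R n B = [set v | forall i, `[- B, B]%classic (v ord0 i)].
  by apply/seteqP; split => y /= yB i; have := yB i; rewrite /= in_itv.
by apply: (@rV_compact _ _ (fun=> `[- B, B]%classic)) => _; exact: segment_compact.
Qed.

Lemma compact_bounded_on C g : compact C ->
  (forall z, C z -> {for z, continuous g}) -> bounded_on C g.
Proof.
move=> cC gC.
have [|d d0 dP] := @compact_uniform R n C (fun d z => `|g z| <= d^-1) cC; last by exists d^-1.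
move=> z /gC /cvgrPdist_lt /(_ 1 ltr01) /nbhs_ballP[r /= r0 rP].
exists (Num.min r (`|g z| + 1)^-1).
  by rewrite lt_min r0 invr_gt0 ltr_wpDl.
move=> d z1; rewrite lt_min => /andP[d0 /andP[dr dg]]; rewrite lt_min => /andP[zr _].
have gz1 : `|g z| + 1 <= d^-1.
  rewrite -[leLHS]invrK lef_pV2 ?posrE ?invr_gt0 ?ltr_wpDl//; exact: ltW.
apply: le_trans gz1; have : `|g z - g z1| < 1.
  by apply: rP; rewrite -ball_normE /= distrC.
rewrite distrC => h; rewrite -[g z1](subrK (g z)) addrC.
by apply: le_trans (ler_normD _ _) _; rewrite lerD2l ltW.
Qed.

Lemma bounded_on_cst A (c : R) : bounded_on A (fun=> c).
Proof. by exists `|c|. Qed.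

Lemma bounded_on_add A g h : bounded_on A g -> bounded_on A h ->
  bounded_on A (fun y => g y + h y).
Proof.
move=> [M gM] [N hN]; exists (M + N) => y Ay.
by apply: le_trans (ler_normD _ _) _; rewrite lerD ?gM ?hN.
Qed.

Lemma bounded_on_mul A g h : bounded_on A g -> bounded_on A h ->
  bounded_on A (fun y => g y * h y).
Proof.
move=> [M gM] [N hN]; exists (M * N) => y Ay.
by rewrite normrM ler_pM ?gM ?hN.
Qed.

Lemma bounded_on_sum A m (g : 'I_m -> 'rV[R]_n -> R) :
  (forall i, bounded_on A (g i)) -> bounded_on A (fun y => \sum_i g i y).
Proof.
move=> gb; have [M Mb] := choice gb; exists (\sum_i M i) => y Ay.
by apply: le_trans (ler_norm_sum _ _ _) _; apply: ler_sum => i _; exact: Mb.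
Qed.

Lemma bounded_on_supported A D (K g : 'rV[R]_n -> R) : bounded_on A K ->
  (forall z, ~ D z -> K z = 0) -> bounded_on D g ->
  bounded_on A (fun z => K z * g z).
Proof.
move=> [M KM] K0 [N gN]; exists (`|M| * `|N|) => y Ay.
have [Dy|nDy] := pselect (D y); last by rewrite K0// mul0r normr0 mulr_ge0.
rewrite normrM ler_pM// (le_trans _ (ler_norm _)) ?KM ?gN//.
Qed.
End BoundedFunctions.

(** * Differentiation under the mean and integration by parts *)

Section BoxMean.
Context {R : realType} {n : nat} {B : R} {I : ('rV[R]_n -> R) -> R}.
Hypothesis meanI : box_mean B I.
Implicit Types (y z w a c : 'rV[R]_n) (g h u K : 'rV[R]_n -> R).
Implicit Types (du dh : 'I_n -> 'rV[R]_n -> R) (U C D : set 'rV[R]_n).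

Let bnd := bounded_on (@box R n B).

Lemma mean_cst (x : R) : I (fun=> x) = x.
Proof. by case: meanI. Qed.

Lemma mean_scale (x : R) h : bnd h -> I (fun y => x * h y) = x * I h.
Proof.
move=> bh; have [lin _ _ _ _] := meanI.
have := lin x h (fun=> 0) bh (bounded_on_cst _ _); rewrite mean_cst addr0 => <-.
by congr I; apply/funext => y; rewrite addr0.
Qed.

Lemma mean_add g h : bnd g -> bnd h -> I (fun y => g y + h y) = I g + I h.
Proof.
move=> bg bh; have [lin _ _ _ _] := meanI.
rewrite -[X in X + _]mul1r -lin//.
by congr I; apply/funext => y; rewrite mul1r.
Qed.

Lemma mean_sum m (g : 'I_m -> 'rV[R]_n -> R) : (forall i, bnd (g i)) ->
  I (fun y => \sum_i g i y) = \sum_i I (g i).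
Proof.
elim: m g => [|m IHm] g bg.
  rewrite big_ord0 -[RHS]mean_cst; congr I; apply/funext => y; exact: big_ord0.
rewrite big_ord_recl -IHm => [|i]; last exact: bg.
rewrite -mean_add; [|exact: bg|by apply: bounded_on_sum => i; exact: bg].
by congr I; apply/funext => y; rewrite big_ord_recl.
Qed.

Lemma mean_le g h : bnd g -> bnd h -> (forall y, box B y -> g y <= h y) -> I g <= I h.
Proof. have [_ mono _ _ _] := meanI. move=> bg bh; exact: mono. Qed.

Lemma mean_norm_le h (M : R) : (forall y, box B y -> `|h y| <= M) -> `|I h| <= M.
Proof.
move=> hM; have bh : bnd h by exists M.
rewrite ler_norml -[- M]mean_cst -[X in _ && (_ <= X)]mean_cst.
by apply/andP; split; apply: mean_le => //; try exact: bounded_on_cst;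
  move=> y /hM; rewrite ler_norml => /andP[].
Qed.

(** The dilated support of [K] is compact in [U], so the first-order expansion of [u] is uniform
    there. The mean of its error is then at most [e * |s|], and no passage to the limit inside [I]
    is needed. *)
Lemma mean_dilation_deriv U D K u du c a (r : R) :
  open U -> compact D -> bounded_on setT K ->
  (forall z, ~ D z -> K z = 0) -> C1_on U u du ->
  (forall z, D z -> U (c + r *: (z - a))) ->
  is_derive r 1 (fun t => I (fun z => K z * u (c + t *: (z - a))))
    (I (fun z => K z * \sum_i (z - a) 0 i * du i (c + r *: (z - a)))).
Proof.
move=> oU cD [MK KM] K0 uC1 DU.
pose C := [set c + r *: (z - a) | z in D].
have cC : compact C.
  apply: continuous_compact cD; apply: continuous_subspaceT; exact: affine_continuous.
have CU : C `<=` U by move=> _ [z Dz <-]; exact: DU.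
have bC g : (forall y, U y -> {for y, continuous g}) ->
    bounded_on D (fun z => g (c + r *: (z - a))).
  move=> gU; have [M gM] : bounded_on C g by apply: compact_bounded_on => // y /CU /gU.
  by exists M => z Dz; apply: gM; exists z.
have bu : bnd (fun z => K z * u (c + r *: (z - a))).
  apply: (@bounded_on_supported _ _ _ D) => //; first by exists MK => y _; exact: KM.
  by apply: bC => y /uC1[].
have [Rm RmP] : bounded_on D (fun z => `|z - a|).
  apply: compact_bounded_on => // z _; apply: (@cvg_norm _ _ _ (nbhs z)).
  exact: shift_continuous.
have {}RmP z : D z -> `|z - a| <= Rm.
  by move=> /RmP; rewrite normr_id.
have bS : bnd (fun z => K z * \sum_i (z - a) 0 i * du i (c + r *: (z - a))).
  apply: (@bounded_on_supported _ _ _ D) => //; first by exists MK => y _; exact: KM.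
  apply: bounded_on_sum => i; apply: bounded_on_mul.
    by exists Rm => z /RmP; apply: le_trans; exact: coord_le_norm.
  by apply: bC => y /uC1[_ /(_ i)[]].
apply: linear_approx_deriv => e e0.
have M10 : 0 < `|MK| * `|Rm| + 1 by rewrite ltr_wpDl// mulr_ge0.
have [d d0 dP] := @C1_on_uniform _ _ U C u du (e / (`|MK| * `|Rm| + 1))
  oU cC CU uC1 (divr_gt0 e0 M10).
exists (d / (`|Rm| + 1)); first by rewrite divr_gt0// ltr_wpDl.
move=> s; rewrite ltr_pdivlMr ?ltr_wpDl// => sd.
pose E z := K z * (u (c + (r + s) *: (z - a)) - u (c + r *: (z - a)) -
  s * \sum_i (z - a) 0 i * du i (c + r *: (z - a))).
have EM z : `|E z| <= e * `|s|.
  rewrite /E; have [Dz|nDz] := pselect (D z); last first.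
    by rewrite K0// mul0r normr0 mulr_ge0// ltW.
  have zR : `|z - a| <= `|Rm| by rewrite (le_trans (RmP z Dz))// ler_norm.
  have ws : `|s *: (z - a)| <= `|s| * `|Rm| by rewrite normrZ ler_wpM2l.
  have := dP (c + r *: (z - a)) (ex_intro2 _ _ z Dz erefl) (s *: (z - a)).
  have -> : c + r *: (z - a) + s *: (z - a) = c + (r + s) *: (z - a).
    by rewrite -addrA -scalerDl.
  under eq_bigr do rewrite mxE -mulrA.
  rewrite -mulr_sumr => h; rewrite normrM.
  apply: (@le_trans _ _ (`|MK| * (e / (`|MK| * `|Rm| + 1) * (`|s| * `|Rm|)))).
    apply: ler_pM => //; first by rewrite (le_trans (KM z _))// ler_norm.
    apply: le_trans (h _) _; last by rewrite ler_wpM2l// divr_ge0// ltW.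
    by apply: le_lt_trans ws _; apply: le_lt_trans sd; rewrite ler_wpM2l// lerDl.
  have -> : `|MK| * (e / (`|MK| * `|Rm| + 1) * (`|s| * `|Rm|)) =
      (e * `|s|) * ((`|MK| * `|Rm|) / (`|MK| * `|Rm| + 1)) by ring.
  by rewrite ler_piMr ?mulr_ge0 ?(ltW e0)// ler_pdivrMr// mul1r lerDl.
have bE : bnd E by exists (e * `|s|).
suff -> : I (fun z => K z * u (c + (r + s) *: (z - a))) =
    I E + (I (fun z => K z * u (c + r *: (z - a))) +
    s * I (fun z => K z * \sum_i (z - a) 0 i * du i (c + r *: (z - a)))).
  have cancel_sum (x y t : R) : x + (y + t) - y - t = x by ring.
  by rewrite cancel_sum; apply: mean_norm_le => z _; exact: EM.
rewrite -mean_scale// -mean_add//; last by apply: bounded_on_mul bS; exact: bounded_on_cst.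
rewrite -mean_add//; last first.
  by apply: bounded_on_add => //; apply: bounded_on_mul bS; exact: bounded_on_cst.
by congr I; apply/funext => z; rewrite /E; ring.
Qed.

Lemma mean_partial h dh i : C1_on setT h dh ->
  (forall y, y 0 i <= - B \/ B <= y 0 i -> h y = 0) -> I (dh i) = 0.
Proof.
move=> hC1 h0; have [_ _ _ ibp _] := meanI.
apply: (ibp h (dh i) i _ h0) => [|e e0].
  apply: compact_bounded_on => [|z _]; first exact: box_compact.
  by have [_ /(_ i)[]] := hC1 z Logic.I.
have [d d0 dP] := C1_on_uniform openT (@box_compact R n B) (@subsetT _ _) hC1 e0.
exists d => // s y /andP[s0 sd] yB.
have dn : `|delta_mx 0 i : 'rV[R]_n| <= 1.
  by apply: norm_le_coord => // j; rewrite mxE; case: (_ && _); rewrite ?normr1 ?normr0.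
have sn : `|s *: (delta_mx 0 i : 'rV[R]_n)| <= s.
  by rewrite normrZ gtr0_norm// ler_piMr// ltW.
have := dP y yB (s *: delta_mx 0 i) (le_lt_trans sn sd).
rewrite (bigD1 i)//= big1 => [|j ji]; last by rewrite !mxE (negbTE ji) andbF mulr0 mul0r.
rewrite !mxE !eqxx mulr1 addr0 => /le_trans; apply.
by rewrite ler_pM2l.
Qed.

End BoxMean.

(** * Calculus rules for continuously differentiable functions *)

Section C1Algebra.
Context {R : realType} {n : nat}.
Implicit Types (y z w a c : 'rV[R]_n) (u v : 'rV[R]_n -> R).
Implicit Types (du dv : 'I_n -> 'rV[R]_n -> R) (U D : set 'rV[R]_n).

Lemma continuous_at_add u v y : {for y, continuous u} -> {for y, continuous v} ->
  {for y, continuous (fun z => u z + v z)}.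
Proof. by move=> uy vy; apply: (@cvgD _ _ _ (nbhs y)). Qed.

Lemma continuous_at_mul u v y : {for y, continuous u} -> {for y, continuous v} ->
  {for y, continuous (fun z => u z * v z)}.
Proof. by move=> uy vy; apply: (@cvgM _ _ (nbhs y)). Qed.

Lemma continuous_at_cst (x : R) y : {for y, continuous (fun=> x)}.
Proof. exact: cst_continuous. Qed.

Lemma continuous_at_sum m (u : 'I_m -> 'rV[R]_n -> R) y :
  (forall i, {for y, continuous (u i)}) -> {for y, continuous (fun z => \sum_i u i z)}.
Proof.
elim: m u => [|m IHm] u uy.
  have -> : (fun z => \sum_(i < 0) u i z) = (fun=> 0) by apply/funext => z; rewrite big_ord0.
  exact: continuous_at_cst.
have -> : (fun z => \sum_i u i z) = (fun z => u ord0 z + \sum_(i < m) u (lift ord0 i) z).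
  by apply/funext => z; rewrite big_ord_recl.
by apply: continuous_at_add => //; apply: IHm.
Qed.

Lemma continuous_at_coord a i y : {for y, continuous (fun z => (z - a) 0 i)}.
Proof.
apply: (@continuous_comp _ _ _ (fun z => z - a) (fun z : 'rV[R]_n => z 0 i)).
  exact: shift_continuous.
exact: coord_continuous.
Qed.

Lemma deriv_line0 u y (e : 'rV[R]_n) (l : R) :
  is_derive (0 : R) 1 (fun t => u (y + t *: e)) l -> is_derive y e u l.
Proof. by move=> h; have := (deriv_lineP u y e 0 l).2 h; rewrite scale0r addr0. Qed.

Lemma deriv_line_at0 u y (e : 'rV[R]_n) (l : R) :
  is_derive y e u l -> is_derive (0 : R) 1 (fun t => u (y + t *: e)) l.
Proof. by move=> h; apply/deriv_lineP; rewrite scale0r addr0. Qed.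

Lemma C1_on_sub U U' u du : U' `<=` U -> C1_on U u du -> C1_on U' u du.
Proof. by move=> UU uC y /UU /uC. Qed.

Lemma C1_on_mul U u v du dv : C1_on U u du -> C1_on U v dv ->
  C1_on U (fun z => u z * v z) (fun i z => du i z * v z + u z * dv i z).
Proof.
move=> uC vC y Uy; have [uy duy] := uC y Uy; have [vy dvy] := vC y Uy.
split; first exact: continuous_at_mul.
move=> i; have [ui dui] := duy i; have [vi dvi] := dvy i; split; first exact: deriv_mul.
by apply: continuous_at_add; apply: continuous_at_mul.
Qed.

Lemma C1_on_sum U m (u : 'I_m -> 'rV[R]_n -> R) (du : 'I_m -> 'I_n -> 'rV[R]_n -> R) :
  (forall j, C1_on U (u j) (du j)) ->
  C1_on U (fun z => \sum_j u j z) (fun i z => \sum_j du j i z).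
Proof.
move=> uC y Uy; split.
  by apply: continuous_at_sum => j; have [] := uC j y Uy.
move=> i; split.
  by apply: deriv_sum => j; have [_ /(_ i)[]] := uC j y Uy.
by apply: continuous_at_sum => j; have [_ /(_ i)[]] := uC j y Uy.
Qed.

Lemma C1_on_coord U a i : C1_on U (fun z => (z - a) 0 i) (fun l _ => (i == l)%:R).
Proof.
move=> y _; split; first exact: continuous_at_coord.
move=> l; split; last exact: continuous_at_cst.
apply: deriv_line0.
have -> : (fun t : R => (y + t *: delta_mx 0 l - a) 0 i) =
    (fun t => (y 0 i - a 0 i) + t * (i == l)%:R).
  by apply/funext => t; rewrite !mxE eqxx /= addrAC.
by der; ring.
Qed.

Lemma C1_on_comp U u du (k dk : R -> R) : C1_on U u du ->
  (forall s : R, is_derive s 1 k (dk s)) -> continuous dk ->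
  C1_on U (fun z => k (u z)) (fun i z => dk (u z) * du i z).
Proof.
move=> uC kd dkc y Uy; have [uy duy] := uC y Uy; split.
  by apply: continuous_comp => //; apply: deriv_continuous (kd _).
move=> i; have [ui dui] := duy i; split; last first.
  by apply: continuous_at_mul => //; apply: continuous_comp => //; exact: dkc.
apply: deriv_line0; have := deriv_line_at0 ui.
apply: (@is_derive1_comp _ k (fun t => u (y + t *: delta_mx 0 i))).
by rewrite scale0r addr0; exact: kd.
Qed.

Lemma C1_on_affine U u du c a (r : R) : C1_on U u du ->
  C1_on [set z | U (c + r *: (z - a))] (fun z => u (c + r *: (z - a)))
    (fun i z => r * du i (c + r *: (z - a))).
Proof.
move=> uC y /= Uy; have [uy duy] := uC _ Uy.
have comp_cont (g : 'rV[R]_n -> R) : {for c + r *: (y - a), continuous g} ->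
    {for y, continuous (fun z => g (c + r *: (z - a)))}.
  move=> gc; apply: (@continuous_comp _ _ _ (fun z : 'rV[R]_n => c + r *: (z - a)) g).
    exact: affine_continuous.
  exact: gc.
split; first exact: comp_cont.
move=> i; have [ui dui] := duy i; split; last first.
  by apply: continuous_at_mul; [exact: continuous_at_cst|exact: comp_cont].
apply: deriv_line0.
have -> : (fun t : R => u (c + r *: (y + t *: delta_mx 0 i - a))) =
    (fun t => u (c + r *: (y - a) + t *: delta_mx 0 i)) \o (fun t => r * t).
  apply/funext => t /=; congr u; rewrite addrAC scalerDr scalerA addrA //.
rewrite mulrC; apply: is_derive1_comp; last by der; ring.
by rewrite mulr0; exact: deriv_line_at0.
Qed.

(** Off the closed set [D] the product vanishes on a neighbourhood, whatever values [v] takes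
    outside [U]. The result is continuously differentiable everywhere, as integration by parts over
    the box demands. *)
Lemma C1_on_glue U D u v du dv : closed D -> open U -> D `<=` U ->
  C1_on setT u du -> C1_on U v dv ->
  (forall z, ~ D z -> u z = 0 /\ forall i, du i z = 0) ->
  C1_on setT (fun z => u z * v z) (fun i z => du i z * v z + u z * dv i z).
Proof.
move=> cD oU DU uC vC u0 y _.
have [Dy|nDy] := pselect (D y).
  by apply: (C1_on_mul (C1_on_sub (@subsetT _ U) uC) vC); exact: DU.
have nD : \forall z \near y, ~ D z.
  by apply: open_nbhs_nbhs; split; [exact: closed_openC|].
have zero_cont (g : 'rV[R]_n -> R) : (forall z, ~ D z -> g z = 0) -> {for y, continuous g}.
  move=> g0; rewrite /prop_for /continuous_at (g0 y)//.
  apply: (proj2 (@cvgrPdist_lt _ _ _ (nbhs y) _ g 0)) => e e0.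
  by near=> z; rewrite g0 ?subrr ?normr0//; near: z.
split; first by apply: zero_cont => z /u0[-> _]; rewrite mul0r.
move=> i; split; last first.
  by apply: zero_cont => z /u0[-> ->]; rewrite !mul0r addr0.
have [-> ->] := u0 _ nDy; rewrite !mul0r addr0.
apply: near_eq_is_derive (deriv_cst y _ 0).
by near=> z; have [|-> _] := u0 z; [near: z|rewrite mul0r].
Unshelve. all: by end_near. Qed.
End C1Algebra.

(** * Radial means and the Laplacian *)

Definition sqnorm {R : realType} {n : nat} (z : 'rV[R]_n) : R := \sum_i z 0 i ^+ 2.

(** The profile is a function of the squared distance, which keeps the weight differentiable at the
    centre. One continuous derivative is enough, since the weight is differentiated only once in any
    integration by parts. *)
Definition radial_kernel {R : realType} (lo hi : R) (k dk : R -> R) : Prop :=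
  [/\ forall s : R, is_derive s 1 k (dk s), continuous dk &
      forall s, s <= lo \/ hi <= s -> k s = 0 /\ dk s = 0].

Section RadialMeans.
Context {R : realType} {n : nat} {B : R} {I : ('rV[R]_n -> R) -> R}.
Hypothesis meanI : box_mean B I.
Context {a : 'rV[R]_n} {lo hi : R}.

(** For [lo < 0] this is a closed ball, so rings and balls are treated together. *)
Definition shell : set 'rV[R]_n := [set z | lo <= sqnorm (z - a) <= hi].

Hypothesis shell_box : forall z, shell z -> forall i, `|z 0 i| < B.

Implicit Types (y z c : 'rV[R]_n) (g h u K : 'rV[R]_n -> R) (k dk : R -> R) (t : R).
Implicit Types (du : 'I_n -> 'rV[R]_n -> R) (ddu : 'I_n -> 'I_n -> 'rV[R]_n -> R).
Implicit Types (U : set 'rV[R]_n).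

Lemma C1_on_sqnorm U :
  C1_on U (fun z => sqnorm (z - a)) (fun l z => 2 * (z - a) 0 l).
Proof.
have h := C1_on_sum (fun j => C1_on_mul (@C1_on_coord R n U a j) (@C1_on_coord R n U a j)).
have -> : (fun z => sqnorm (z - a)) = (fun z => \sum_j (z - a) 0 j * (z - a) 0 j).
  by apply/funext => z; apply: eq_bigr => j _; rewrite expr2.
suff <- : (fun l z => \sum_j ((j == l)%:R * (z - a) 0 j + (z - a) 0 j * (j == l)%:R)) =
    (fun l z => 2 * (z - a) 0 l) :> ('I_n -> 'rV[R]_n -> R) by exact: h.
apply/funext => l; apply/funext => z; rewrite (bigD1 l)//= eqxx big1 => [|j jl].
  by rewrite addr0 mul1r mulr1 mulr2n mulrDl mul1r.
by rewrite (negbTE jl) mul0r mulr0 addr0.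
Qed.

Lemma shell_closed : closed shell.
Proof.
have sc : continuous (fun z : 'rV[R]_n => sqnorm (z - a)).
  by move=> z; have [] := C1_on_sqnorm (U := setT) Logic.I (y := z).
have -> : shell = (fun z => sqnorm (z - a)) @^-1` `[lo, hi]%classic.
  by apply/seteqP; split => z; rewrite /= in_itv.
by apply: preimage_closed; [move=> z _; exact: sc|exact: interval_closed].
Qed.

Lemma shell_compact : compact shell.
Proof.
apply: (subclosed_compact shell_closed (@box_compact R n B)) => z /shell_box zB i.
by have := zB i; rewrite ltr_norml => /andP[? ?]; rewrite !ltW.
Qed.

Section Kernel.
Context {k dk : R -> R}.
Hypothesis kern : radial_kernel lo hi k dk.

Let K z := k (sqnorm (z - a)).

Lemma kernel_outside z : ~ shell z -> K z = 0 /\ dk (sqnorm (z - a)) = 0.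
Proof.
have [_ _ k0] := kern => nz; apply: k0.
have [h|h] := leP (sqnorm (z - a)) lo; first by left.
by right; rewrite leNgt; apply/negP => h2; apply: nz; rewrite /shell /= !ltW.
Qed.

Lemma C1_on_kernel : C1_on setT K (fun l z => dk (sqnorm (z - a)) * (2 * (z - a) 0 l)).
Proof.
by have [kd dkc _] := kern; exact: (C1_on_comp (@C1_on_sqnorm setT) kd dkc).
Qed.

Lemma kernel_continuous z : {for z, continuous K}.
Proof. by have [] := C1_on_kernel Logic.I (y := z). Qed.

Lemma mul_kernel_bounded g : (forall z, shell z -> {for z, continuous g}) ->
  bounded_on setT (fun z => K z * g z).
Proof.
move=> gc; apply: (@bounded_on_supported _ _ _ shell).
- have [M KM] := compact_bounded_on shell_compact (fun z _ => @kernel_continuous z).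
  exists (`|M|) => z _; have [Dz|nDz] := pselect (shell z).
    by rewrite (le_trans (KM z Dz))// ler_norm.
  by have [-> _] := kernel_outside nDz; rewrite normr0.
- by move=> z /kernel_outside[].
- exact: (compact_bounded_on shell_compact).
Qed.

Section Dilation.
Context {U : set 'rV[R]_n} {c : 'rV[R]_n}.
Hypothesis U_open : open U.

Let ok t := forall z, shell z -> U (c + t *: (z - a)).

(** Openness of the admissible dilations lets the mean of a sum be split into a sum of means on a
    whole neighbourhood of [t], as differentiating [radial_mean1] requires. *)
Lemma ok_near t : ok t -> \forall s \near t, ok s.
Proof.
move=> okt; pose C := [set c + t *: (z - a) | z in shell].
have cC : compact C.
  apply: continuous_compact shell_compact; apply: continuous_subspaceT.
  exact: affine_continuous.
have [|d d0 dP] := @compact_uniform R n C (fun d y => forall y', `|y' - y| < d -> U y') cC.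
  move=> y [z Dz <-]; have : nbhs (c + t *: (z - a)) U.
    by apply: open_nbhs_nbhs; split => //; exact: okt.
  move=> /nbhs_ballP[e /= e0 eU]; exists (e / 2); first by rewrite divr_gt0.
  move=> d y1 /andP[d0 de] y1z y2 y21; apply: eU; rewrite -ball_normE /= distrC.
  by rewrite (le_lt_trans (ler_distD y1 _ _))// [ltRHS]splitr ltrD// (lt_trans y21).
have [M MP] : bounded_on shell (fun z => `|z - a|).
  apply: (compact_bounded_on shell_compact) => z _.
  by apply: (@cvg_norm _ _ _ (nbhs z)); exact: shift_continuous.
have M0 : 0 < `|M| + 1 by rewrite ltr_wpDl.
exists (d / (`|M| + 1)) => /=; first by rewrite divr_gt0.
move=> s /=; rewrite ltr_pdivlMr// => sd z Dz.
apply: (dP (c + t *: (z - a)) _ _ _); first by exists z.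
rewrite opprD addrACA subrr add0r -scalerBl normrZ distrC.
apply: le_lt_trans sd; rewrite ler_wpM2l// -[leLHS]normr_id.
by rewrite (le_trans (MP z Dz))// (le_trans (ler_norm M))// lerDl.
Qed.

Lemma dilation_bounded t h g : ok t -> (forall z, {for z, continuous h}) ->
  (forall y, U y -> {for y, continuous g}) ->
  bounded_on (box B) (fun z => K z * (h z * g (c + t *: (z - a)))).
Proof.
move=> okt hc gc.
have [z Dz|M KM] := @mul_kernel_bounded (fun z => h z * g (c + t *: (z - a))).
  apply: continuous_at_mul => //.
  apply: (@continuous_comp _ _ _ (fun z : 'rV[R]_n => c + t *: (z - a)) g).
    exact: affine_continuous.
  by apply: gc; exact: okt.
by exists M => z _; exact: KM.
Qed.

Context {u : 'rV[R]_n -> R} {du : 'I_n -> 'rV[R]_n -> R} {ddu : 'I_n -> 'I_n -> 'rV[R]_n -> R}.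
Hypotheses (uC1 : C1_on U u du) (duC1 : forall i, C1_on U (du i) (ddu i)).

Definition radial_mean g t := I (fun z => K z * g (c + t *: (z - a))).

Definition radial_mean1 t :=
  I (fun z => K z * \sum_i (z - a) 0 i * du i (c + t *: (z - a))).

Definition radial_mean2 t := \sum_i
  I (fun z => (K z * (z - a) 0 i) * \sum_j (z - a) 0 j * ddu i j (c + t *: (z - a))).

Lemma kernel_bounded : bounded_on setT K.
Proof.
have [//|M KM] := @mul_kernel_bounded (fun=> 1).
  by move=> z _; exact: continuous_at_cst.
by exists M => z _; rewrite -[K z]mulr1 KM.
Qed.

Lemma radial_mean_deriv t : ok t -> is_derive t 1 (radial_mean u) (radial_mean1 t).
Proof.
move=> okt; apply: (mean_dilation_deriv meanI U_open shell_compact kernel_bounded) => //.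
by move=> z /kernel_outside[].
Qed.

Lemma radial_mean1_deriv t : ok t -> is_derive t 1 radial_mean1 (radial_mean2 t).
Proof.
move=> okt.
have bK i : bounded_on setT (fun z => K z * (z - a) 0 i).
  by apply: mul_kernel_bounded => z _; exact: continuous_at_coord.
have : is_derive t 1 (fun s => \sum_i I (fun z => (K z * (z - a) 0 i) * du i (c + s *: (z - a))))
    (radial_mean2 t).
  apply: deriv_sum => i.
  apply: (mean_dilation_deriv meanI U_open shell_compact (bK i)) => //.
  by move=> z /kernel_outside[-> _]; rewrite mul0r.
apply: near_eq_is_derive; near=> s.
have oks : ok s by near: s; exact: ok_near.
rewrite -(mean_sum meanI); last first.
  move=> i.
  have -> : (fun z => K z * (z - a) 0 i * du i (c + s *: (z - a))) =
      (fun z => K z * ((z - a) 0 i * du i (c + s *: (z - a)))).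
    by apply/funext => z; rewrite mulrA.
  apply: (dilation_bounded oks); first by move=> z; exact: continuous_at_coord.
  by move=> y /uC1[_ /(_ i)[]].
rewrite /radial_mean1; congr I; apply/funext => z.
by rewrite mulr_sumr; apply: eq_bigr => i _; rewrite mulrA.
Unshelve. all: by end_near. Qed.

(* Integrating [d_j (y_i y_j p_i K) - d_i (y_j^2 p_i K)] with [y = z - a] and
   [p_i z = du i (c + t y)] gives [0]; the derivatives of the radial kernel
   cancel, which turns radial second derivatives into the Laplacian. *)
Lemma radial_mean_laplacian t : ok t ->
  t * radial_mean2 t + (n%:R - 1) * radial_mean1 t =
  t * I (fun z => K z * (sqnorm (z - a) * \sum_i ddu i i (c + t *: (z - a)))).
Proof.
move=> okt.
pose x (i : 'I_n) (z : 'rV[R]_n) : R := (z - a) 0 i.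
pose p (i : 'I_n) (z : 'rV[R]_n) : R := du i (c + t *: (z - a)).
pose q (i j : 'I_n) (z : 'rV[R]_n) : R := ddu i j (c + t *: (z - a)).
pose dK (z : 'rV[R]_n) : R := dk (sqnorm (z - a)) * 2.
pose A (i j : 'I_n) (z : 'rV[R]_n) : R := x i z * x j z * K z.
pose dA (i j l : 'I_n) (z : 'rV[R]_n) : R := ((i == l)%:R * x j z + x i z * (j == l)%:R) * K z +
  x i z * x j z * (dK z * x l z).
have AC1 i j : C1_on setT (A i j) (dA i j).
  have := C1_on_mul
    (C1_on_mul (@C1_on_coord R n setT a i) (@C1_on_coord R n setT a j)) C1_on_kernel.
  congr (C1_on _ _ _); apply/funext => l; apply/funext => z.
  by rewrite /dA /dK /x; ring.
have Ap i j m : C1_on setT (fun z => A i j z * p m z)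
    (fun l z => dA i j l z * p m z + A i j z * (t * q m l z)).
  apply: (@C1_on_glue R n [set z | U (c + t *: (z - a))] shell) => //.
  - exact: shell_closed.
  - by apply: open_comp => // z _; exact: affine_continuous.
  - exact: C1_on_affine.
  - move=> z /kernel_outside[K0 dK0]; rewrite /A K0 mulr0; split=> // l.
    by rewrite /dA /dK K0 dK0 !mul0r !mulr0 addr0.
have bAp i j l m :
    bounded_on (box B) (fun z => dA i j l z * p m z + A i j z * (t * q m l z)).
  apply: compact_bounded_on => [|z _]; first exact: box_compact.
  by have [_ /(_ l)[]] := Ap i j m z Logic.I.
have ibp i j l m : I (fun z => dA i j l z * p m z + A i j z * (t * q m l z)) = 0.
  apply: (@mean_partial R n B I meanI (fun z => A i j z * p m z)
    (fun l z => dA i j l z * p m z + A i j z * (t * q m l z)) l) => //.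
  move=> y yB; have /kernel_outside[K0 _] : ~ shell y.
    move=> /shell_box /(_ l); rewrite ltr_norml => /andP[y1 y2].
    by case: yB; rewrite leNgt ?y1 ?y2.
  by rewrite /A K0 mulr0 mul0r.
pose S i j z := (dA i j j z * p i z + A i j z * (t * q i j z)) +
  (-1) * (dA j j i z * p i z + A j j z * (t * q i i z)).
have bS i j : bounded_on (box B) (S i j).
  apply: bounded_on_add; first exact: bAp.
  by apply: bounded_on_mul; [exact: bounded_on_cst|exact: bAp].
have IS : I (fun z => \sum_i \sum_j S i j z) = 0.
  rewrite (mean_sum meanI) => [|i]; last exact: bounded_on_sum.
  apply: big1 => i _; rewrite (mean_sum meanI)//; apply: big1 => j _.
  rewrite (mean_add meanI) ?(mean_scale meanI) ?ibp ?mulr0 ?addr0//.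
  by apply: bounded_on_mul; [exact: bounded_on_cst|exact: bAp].
(* In [S i j] the coefficient of [K p_i] is [x_i] minus [x_j] on the diagonal; summed over [j] this
   is [(n - 1) x_i], the source of the dimensional constant. *)
have SE z : \sum_i \sum_j S i j z =
    t * \sum_i ((K z * x i z) * \sum_j x j z * q i j z) +
    ((n%:R - 1) * (K z * \sum_i x i z * p i z) +
    (- t) * (K z * (sqnorm (z - a) * \sum_i q i i z))).
  rewrite !mulr_sumr -!big_split /=; apply: eq_bigr => i _.
  have -> : \sum_j S i j z = \sum_j ((t * (K z * x i z)) * (x j z * q i j z) +
      (K z * x i z * p i z + (- ((i == j)%:R * (K z * p i z * x j z)) +
      (- (t * K z * q i i z)) * (x j z ^+ 2)))).
    apply: eq_bigr => j _; rewrite /S /dA /A !eqxx [j == i]eq_sym mulr1n; ring.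
  rewrite !big_split /= -!mulr_sumr sumr_const card_ord sumrN.
  have -> : \sum_j (i == j)%:R * (K z * p i z * x j z) = K z * p i z * x i z.
    rewrite (bigD1 i)//= eqxx mul1r big1 ?addr0// => j ji.
    by rewrite eq_sym (negbTE ji) mul0r.
  by rewrite -mulr_natl -/(sqnorm (z - a)); ring.
have cp m z : shell z -> {for z, continuous (p m)}.
  move=> Dz; apply: (@continuous_comp _ _ _ (fun z : 'rV[R]_n => c + t *: (z - a)) (du m)).
    exact: affine_continuous.
  by have [] := duC1 m (okt z Dz).
have cq i j z : shell z -> {for z, continuous (q i j)}.
  move=> Dz; apply: (@continuous_comp _ _ _ (fun z : 'rV[R]_n => c + t *: (z - a)) (ddu i j)).
    exact: affine_continuous.
  by have [_ /(_ j)[]] := duC1 i (okt z Dz).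
have bk g : (forall z, shell z -> {for z, continuous g}) ->
    bounded_on (box B) (fun z => K z * g z).
  by move=> /mul_kernel_bounded[M KM]; exists M => z _; exact: KM.
have cx i z : {for z, continuous (x i)} by exact: continuous_at_coord.
have b1 : bounded_on (box B) (fun z => K z * \sum_i x i z * p i z).
  apply: bk => z Dz; apply: continuous_at_sum => i; apply: continuous_at_mul => //.
  exact: cp.
have b2 i : bounded_on (box B) (fun z => (K z * x i z) * \sum_j x j z * q i j z).
  have -> : (fun z => (K z * x i z) * \sum_j x j z * q i j z) =
      (fun z => K z * (x i z * \sum_j x j z * q i j z)).
    by apply/funext => z; rewrite mulrA.
  apply: bk => z Dz; apply: continuous_at_mul => //; apply: continuous_at_sum => j.
  by apply: continuous_at_mul => //; exact: cq.
have b3 : bounded_on (box B) (fun z => K z * (sqnorm (z - a) * \sum_i q i i z)).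
  apply: bk => z Dz; apply: continuous_at_mul.
    by have [] := C1_on_sqnorm (U := setT) Logic.I (y := z).
  by apply: continuous_at_sum => j; exact: cq.
have bc (r : R) g : bounded_on (box B) g -> bounded_on (box B) (fun z => r * g z).
  by move=> bg; apply: bounded_on_mul => //; exact: bounded_on_cst.
move: IS; under eq_fun do rewrite SE.
rewrite (mean_add meanI); [|exact/bc/bounded_on_sum|by apply: bounded_on_add; exact: bc].
rewrite (mean_add meanI); [|exact: bc|exact: bc].
rewrite !(mean_scale meanI)//; last exact: bounded_on_sum.
rewrite (mean_sum meanI)// -/(radial_mean2 t) -/(radial_mean1 t) mulNr => /eqP.
by rewrite addrA subr_eq0 => /eqP.
Qed.

End Dilation.
End Kernel.
End RadialMeans.

(** * A continuously differentiable bump *)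

Section Bump.
Context {R : realType}.
Implicit Types (s lo hi : R).

Definition pos_part s : R := Num.max 0 s.

Lemma pos_part_sqr_deriv s : is_derive s 1 (fun x => pos_part x ^+ 2) (2 * pos_part s).
Proof.
apply: linear_approx_deriv => e e0; exists e => // h he.
apply: (@le_trans _ _ (h ^+ 2)); last first.
  by rewrite -real_normK ?num_real// expr2 ler_wpM2r// ltW.
rewrite /pos_part ler_norml; have h0 := sqr_ge0 h.
have [sh|sh] := leP 0 (s + h); have [s0|s0] := leP 0 s; apply/andP; split; nra.
Qed.

Lemma pos_part_continuous : continuous pos_part.
Proof.
move=> s; apply/cvgrPdist_lt => e e0; near=> x.
apply: (@le_lt_trans _ _ `|s - x|); last first.
  by near: x; exact: (cvgr_dist_lt (F := nbhs s) (fun x => x)).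
rewrite /pos_part; have [s0|s0] := leP 0 s; have [x0|x0] := leP 0 x; rewrite ?subrr ?normr0//.
- by rewrite subr0 ger0_norm// ger0_norm; lra.
- by rewrite sub0r normrN ger0_norm// ler0_norm; lra.
Unshelve. all: by end_near. Qed.

(** Squared positive parts have the continuous derivative that a kernel needs, and on the support
    the bump is a polynomial. *)
Definition bump lo hi s : R := pos_part (s - lo) ^+ 2 * pos_part (hi - s) ^+ 2.

Definition dbump lo hi s : R :=
  2 * pos_part (s - lo) * pos_part (hi - s) ^+ 2 -
  pos_part (s - lo) ^+ 2 * (2 * pos_part (hi - s)).

Lemma bump_kernel lo hi : radial_kernel lo hi (bump lo hi) (dbump lo hi).
Proof.
split.
- move=> s; rewrite /bump /dbump.
  have l1 : is_derive s 1 (fun x => x - lo) 1 by der; ring.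
  have l2 : is_derive s 1 (fun x => hi - x) (-1).
    by apply: (is_derive_eq (deriv_add (deriv_cst s 1 hi) (deriv_opp (deriv_id s)))); ring.
  have d1 := @is_derive1_comp R (fun x => pos_part x ^+ 2) _ s _ _ (pos_part_sqr_deriv _) l1.
  have d2 := @is_derive1_comp R (fun x => pos_part x ^+ 2) _ s _ _ (pos_part_sqr_deriv _) l2.
  apply: (is_derive_eq (deriv_mul d1 d2)) => /=; ring.
- have c1 : continuous (fun s => pos_part (s - lo)).
    move=> s; apply: (@continuous_comp _ _ _ (fun x => x - lo) pos_part).
      by apply: cvgB; [exact: cvg_id|exact: cvg_cst].
    exact: pos_part_continuous.
  have c2 : continuous (fun s => pos_part (hi - s)).
    move=> s; apply: (@continuous_comp _ _ _ (fun x => hi - x) pos_part).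
      by apply: cvgB; [exact: cvg_cst|exact: cvg_id].
    exact: pos_part_continuous.
  move=> s; apply: cvgB; apply: cvgM.
  + by apply: cvgM; [exact: cvg_cst|exact: c1].
  + by apply: cvgM; exact: c2.
  + by apply: cvgM; exact: c1.
  + by apply: cvgM; [exact: cvg_cst|exact: c2].
- move=> s; rewrite /bump /dbump /pos_part => -[h|h].
    by rewrite (max_idPl (_ : s - lo <= 0)) ?subr_le0// expr0n /= !(mul0r, mulr0) subrr.
  by rewrite (max_idPl (_ : hi - s <= 0)) ?subr_le0// expr0n /= !(mul0r, mulr0) subrr.
Qed.

Lemma bump_ge0 lo hi s : 0 <= bump lo hi s.
Proof. by rewrite /bump mulr_ge0 ?sqr_ge0. Qed.

Lemma bumpE lo hi s : lo <= s <= hi -> bump lo hi s = (s - lo) ^+ 2 * (hi - s) ^+ 2.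
Proof.
by move=> /andP[h1 h2]; rewrite /bump /pos_part !(max_idPr _) ?subr_ge0.
Qed.

(** Provides the kernel for [W]: differentiating twice in the dilation factor multiplies the weight
    by the squared distance. *)
Lemma radial_kernel_mulX lo hi (k dk : R -> R) : radial_kernel lo hi k dk ->
  radial_kernel lo hi (fun s => s * k s) (fun s => k s + s * dk s).
Proof.
move=> [kd dkc k0]; split.
- by move=> s; have := kd s => h; der; ring.
- move=> s; apply: cvgD; first exact: (deriv_continuous (kd s)).
  by apply: cvgM; [exact: cvg_id|exact: dkc].
- by move=> s /k0[-> ->]; rewrite mulr0 addr0.
Qed.
End Bump.

(** The dilation identity is applied twice, first to [v] with profile [b s], then to [w] with
    profile [s * b s]; hence the squared [sqnorm] in the source term. *)
Lemma mean_radial_system {R : realType} {k : nat} {B : R}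
    {I : ('rV[R]_k.+3 -> R) -> R} (meanI : box_mean B I)
    (a : 'rV[R]_k.+3) (lo hi : R) (shell_box : forall z, @shell R k.+3 a lo hi z ->
      forall i, `|z 0 i| < B)
    (b db : R -> R) (kern : radial_kernel lo hi b db)
    (U : set 'rV[R]_k.+3) (c : 'rV[R]_k.+3) (U_open : open U)
    (v w g : 'rV[R]_k.+3 -> R) (dv dw : 'I_k.+3 -> 'rV[R]_k.+3 -> R)
    (ddv ddw : 'I_k.+3 -> 'I_k.+3 -> 'rV[R]_k.+3 -> R) (D : set R) :
  C1_on U v dv -> (forall i, C1_on U (dv i) (ddv i)) ->
  C1_on U w dw -> (forall i, C1_on U (dw i) (ddw i)) ->
  (forall y, U y -> w y = \sum_i ddv i i y) ->
  (forall y, U y -> g y = - \sum_i ddw i i y) ->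
  (forall t, D t -> forall z, @shell R k.+3 a lo hi z -> U (c + t *: (z - a))) ->
  exists H1 H2 W W1 W2, radial_system k D
    (fun t => I (fun z => b (sqnorm (z - a)) * v (c + t *: (z - a)))) H1 H2 W W1 W2
    (fun t => I (fun z => b (sqnorm (z - a)) * sqnorm (z - a) ^+ 2 * g (c + t *: (z - a)))).
Proof.
move=> vC dvC wC dwC wE gE DU.
have kern2 := radial_kernel_mulX kern.
pose b2 s := s * b s.
exists (@radial_mean1 R k.+3 I a b c dv), (@radial_mean2 R k.+3 I a b c ddv).
exists (@radial_mean R k.+3 I a b2 c w), (@radial_mean1 R k.+3 I a b2 c dw).
exists (@radial_mean2 R k.+3 I a b2 c ddw).
have out z : ~ @shell R k.+3 a lo hi z -> b (sqnorm (z - a)) = 0.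
  by move=> nz; have [] := kernel_outside kern nz.
have n1 : k.+2%:R = k.+3%:R - 1 :> R by rewrite -[in RHS]natr1 addrK.
move=> t Dt; have okt := DU t Dt; split.
- split.
    exact: (radial_mean_deriv meanI shell_box kern U_open vC okt).
  exact: (radial_mean1_deriv meanI shell_box kern U_open vC dvC okt).
- split.
    exact: (radial_mean_deriv meanI shell_box kern2 U_open wC okt).
  exact: (radial_mean1_deriv meanI shell_box kern2 U_open wC dwC okt).
- rewrite n1 (radial_mean_laplacian meanI shell_box kern U_open dvC okt).
  congr (_ * I _); apply/funext => z; rewrite /b2.
  have [Dz|nDz] := pselect (@shell R k.+3 a lo hi z); last by rewrite out// mulr0 !mul0r.
  by rewrite wE; [ring|exact: okt].
- rewrite n1 (radial_mean_laplacian meanI shell_box kern2 U_open dwC okt).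
  set X := (X in I X).
  have bX : bounded_on (box B) X.
    have [z Dz|M XM] := mul_kernel_bounded shell_box kern2
        (g := fun z => sqnorm (z - a) * \sum_i ddw i i (c + t *: (z - a))).
      apply: continuous_at_mul; first by have [] := @C1_on_sqnorm R k.+3 a setT z Logic.I.
      apply: continuous_at_sum => i.
      apply: (@continuous_comp _ _ _ (fun z : 'rV[R]_k.+3 => c + t *: (z - a)) (ddw i i)).
        exact: affine_continuous.
      by have [_ /(_ i)[]] := dwC i _ (okt z Dz).
    by exists M => z _; exact: XM.
  rewrite -mulrN; congr (_ * _); apply: oppr_inj; rewrite opprK.
  rewrite -mulN1r -(mean_scale meanI)//; congr I; apply/funext => z; rewrite /X.
  have [Dz|nDz] := pselect (@shell R k.+3 a lo hi z); last by rewrite out// mulr0 !mul0r mulr0.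
  by rewrite gE; [ring|exact: okt].
Qed.

Lemma Ck_on_C1 {R : realType} {n k : nat} (U : set 'rV[R]_n) (v : 'rV[R]_n -> R) :
  Ck_on U k.+1 v -> C1_on U v (fun i => partial i v) /\
  forall i, Ck_on U k (partial i v).
Proof.
move=> [vc dv]; split=> [y Uy|i]; last by have [] := dv i.
split=> [|i]; first by apply: vc; rewrite inE.
have [vi Ci] := dv i; split.
  by split=> //; apply: vi; rewrite inE.
by case: k Ci {dv} => [|k] [+ _]; apply; rewrite inE.
Qed.

(* [laplacian v] is only known to agree with a sum of derivatives of [v] on
   [U], so its own derivatives are read off through that sum. *)
Lemma Ck_on_biharmonic {R : realType} {n : nat} (U : set 'rV[R]_n) (v : 'rV[R]_n -> R) :
  open U -> Ck_on U 4 v ->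
  exists dv ddv dw ddw, [/\ C1_on U v dv /\ (forall i, C1_on U (dv i) (ddv i)),
    C1_on U (laplacian v) dw /\ (forall i : 'I_n, C1_on U (dw i) (ddw i)),
    forall y, laplacian v y = \sum_i ddv i i y &
    forall y, U y -> laplacian (laplacian v) y = \sum_i ddw i i y].
Proof.
move=> oU C4; have [v1 C3] := Ck_on_C1 C4.
have v2 i := (Ck_on_C1 (C3 i)).1; have C2 i := (Ck_on_C1 (C3 i)).2.
have v3 i j := (Ck_on_C1 (C2 i j)).1; have C1 i j := (Ck_on_C1 (C2 i j)).2.
have v4 i j l := (Ck_on_C1 (C1 i j l)).1.
pose dw l y := \sum_i partial l (partial i (partial i v)) y.
pose ddw l m y := \sum_i partial m (partial l (partial i (partial i v))) y.
have wC : C1_on U (laplacian v) dw by apply: C1_on_sum => i; exact: v3.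
have dwC l : C1_on U (dw l) (ddw l).
  by apply: C1_on_sum => i; exact: v4.
exists (fun i => partial i v), (fun i j => partial j (partial i v)), dw, ddw; split=> // y Uy.
apply: eq_bigr => i _; have [_ /(_ i)[[_ dwi] _]] := dwC i y Uy.
rewrite -dwi /partial; apply: near_eq_derive.
have nU : nbhs y U by apply: open_nbhs_nbhs; split.
apply: (@filterS _ (nbhs y) _ U) nU => z Uz.
by have [_ /(_ i)[[_ e] _]] := wC z Uz; exact: e.
Qed.

(** * Averages of a positive solution *)

Lemma eq_continuous_at {X Y : topologicalType} (p q : X -> Y) (x : X) :
  p =1 q -> {for x, continuous p} -> {for x, continuous q}.
Proof. by move/funext->. Qed.

(** * Squared Euclidean norm *)

Section SquaredNorm.
Context {R : realType} {n : nat}.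
Implicit Types (x y z e : 'rV[R]_n) (d t : R).

Lemma sqnorm_ge0 z : 0 <= sqnorm z.
Proof. by apply: sumr_ge0 => i _; exact: sqr_ge0. Qed.

Lemma sqnorm_coord z i : z 0 i ^+ 2 <= sqnorm z.
Proof.
by rewrite /sqnorm (bigD1 i)//= lerDl; apply: sumr_ge0 => j _; exact: sqr_ge0.
Qed.

Lemma sqnormZ t z : sqnorm (t *: z) = t ^+ 2 * sqnorm z.
Proof. by rewrite /sqnorm mulr_sumr; apply: eq_bigr => i _; rewrite mxE exprMn. Qed.

Lemma young_coord (d a b : R) : 0 < d -> `|2 * a * b| <= d * a ^+ 2 + d^-1 * b ^+ 2.
Proof.
move=> d0; have e : d * d^-1 = 1 by rewrite divff ?gt_eqF.
have h1 : 0 <= d^-1 * (d * a - b) ^+ 2 by rewrite mulr_ge0 ?sqr_ge0// invr_ge0 ltW.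
have h2 : 0 <= d^-1 * (d * a + b) ^+ 2 by rewrite mulr_ge0 ?sqr_ge0// invr_ge0 ltW.
have E1 : d^-1 * (d * a - b) ^+ 2 = d * a ^+ 2 - 2 * a * b + d^-1 * b ^+ 2.
  by field; rewrite gt_eqF.
have E2 : d^-1 * (d * a + b) ^+ 2 = d * a ^+ 2 + 2 * a * b + d^-1 * b ^+ 2.
  by field; rewrite gt_eqF.
by rewrite E1 in h1; rewrite E2 in h2; rewrite ler_norml; apply/andP; split; lra.
Qed.

Lemma sqnorm_ge d e z : 0 < d ->
  (1 - d) * sqnorm e + (1 - d^-1) * sqnorm (z - e) <= sqnorm z.
Proof.
move=> d0; rewrite /sqnorm !mulr_sumr -big_split; apply: ler_sum => i _ /=.
have := young_coord (e 0 i) ((z - e) 0 i) d0; rewrite !mxE ler_norml => /andP[h _].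
by nra.
Qed.

Lemma sqnorm_le d e z : 0 < d ->
  sqnorm z <= (1 + d) * sqnorm e + (1 + d^-1) * sqnorm (z - e).
Proof.
move=> d0; rewrite /sqnorm !mulr_sumr -big_split; apply: ler_sum => i _ /=.
have := young_coord (e 0 i) ((z - e) 0 i) d0; rewrite !mxE ler_norml => /andP[_ h].
by nra.
Qed.

Lemma sqnorm_shell e z : sqnorm e = 16 -> sqnorm (z - e) <= 1 -> 9 <= sqnorm z <= 25.
Proof.
(* The weight [1/4] makes Young's inequality as sharp as the triangle inequality for lengths 4 and
   1: [12 - 3 = 9] and [20 + 5 = 25]. *)
move=> e16 ze; have d0 : 0 < 4^-1 :> R by [].
have := sqnorm_ge e z d0; have := sqnorm_le e z d0; rewrite e16 invrK.
have := sqnorm_ge0 (z - e); lra.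
Qed.
End SquaredNorm.

(** * Weights on a ring and on unit balls *)

Section Averages.
Context {R : realType} {k : nat} {I : ('rV[R]_k.+3 -> R) -> R}.
Hypothesis meanI : box_mean 8 I.
Implicit Types (x y z e : 'rV[R]_k.+3) (s t : R).

(** The ring [2 <= |z| <= 6] contains, with room to spare, every unit ball centred at distance 4;
    the ball weights are supported on those balls. *)
Definition ring_weight z : R := bump 4 36 (sqnorm z).
Definition ball_weight e z : R := bump (-1) 1 (sqnorm (z - e)).

Lemma sqr_lt_norm (a b : R) : 0 <= b -> a ^+ 2 < b ^+ 2 -> `|a| < b.
Proof.
move=> b0 h; rewrite -sqrtr_sqr -[b]ger0_norm// -sqrtr_sqr ltr_sqrt//.
exact: le_lt_trans (sqr_ge0 a) h.
Qed.

Lemma ring_shell_box z : @shell R k.+3 0 4 36 z -> forall i, `|z 0 i| < 8.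
Proof.
rewrite /shell /= subr0 => /andP[_ z36] i; apply: sqr_lt_norm => //.
by have := sqnorm_coord z i; lra.
Qed.

Lemma ball_shell_box e : sqnorm e = 16 ->
  forall z, @shell R k.+3 e (-1) 1 z -> forall i, `|z 0 i| < 8.
Proof.
move=> e16 z; rewrite /shell /= => /andP[_ ze] i; apply: sqr_lt_norm => //.
have /andP[_ z25] := sqnorm_shell e16 ze.
by have := sqnorm_coord z i; lra.
Qed.

Lemma ball_weight_le_ring e z : sqnorm e = 16 -> ball_weight e z <= ring_weight z.
Proof.
move=> e16; have [ze|ze] := leP (sqnorm (z - e)) 1; last first.
  have [_ _ /(_ (sqnorm (z - e)))[|h _]] := @bump_kernel R (-1) 1; first by right; exact: ltW.
  by rewrite /ball_weight h bump_ge0.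
have /andP[z9 z25] := sqnorm_shell e16 ze; have ze0 := sqnorm_ge0 (z - e).
rewrite /ball_weight /ring_weight !bumpE; try lra.
(* With [s = |z - e|^2] the ball weight is [(1 - s^2)^2 <= 1], while for [9 <= |z|^2 <= 25] the ring
   weight is at least [5^2 * 11^2]. *)
apply: (@le_trans _ _ 1).
  by rewrite -exprMn -[leRHS](expr1n _ 2) lerXn2r ?nnegrE//; nra.
by rewrite -exprMn -[leLHS](expr1n _ 2) lerXn2r ?nnegrE//; nra.
Qed.

Lemma ring_weight_ge0 z : 0 <= ring_weight z. Proof. exact: bump_ge0. Qed.

Lemma ring_weight_out z : ~ @shell R k.+3 0 4 36 z -> ring_weight z = 0.
Proof.
by move=> nz; have [] := kernel_outside (@bump_kernel R 4 36) nz; rewrite subr0.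
Qed.

Lemma ring_bounded (g : 'rV[R]_k.+3 -> R) :
  (forall z, @shell R k.+3 0 4 36 z -> {for z, continuous g}) ->
  bounded_on (box 8) (fun z => ring_weight z * g z).
Proof.
move=> gc; have [M KM] := mul_kernel_bounded ring_shell_box (@bump_kernel R 4 36) gc.
by exists M => z _; have := KM z Logic.I; rewrite subr0.
Qed.

Lemma ring_weight_bounded : bounded_on (box 8) ring_weight.
Proof.
have [z _|M KM] := @ring_bounded (fun=> 1); first exact: continuous_at_cst.
by exists M => z zB; have := KM z zB; rewrite mulr1.
Qed.

Lemma ball_weight_bounded e : sqnorm e = 16 -> bounded_on (box 8) (ball_weight e).
Proof.
move=> e16; have [M KM] := kernel_bounded (ball_shell_box e16) (@bump_kernel R (-1) 1).
by exists M => z _; exact: KM.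
Qed.

(** The half-width [1 / (2 n)] puts a cube about [e] inside [|y - e|^2 <= 1/4], where the weight is
    at least [(3/4)^2 = 9/16]. The bound is uniform in [e] because the one for cubes is uniform in
    the centre. *)
Lemma ball_weight_mass : exists2 m : R, 0 < m &
  forall e, sqnorm e = 16 -> m <= I (ball_weight e).
Proof.
pose eta : R := (2 * k.+3%:R)^-1.
have k1 : 1 <= k.+3%:R :> R by rewrite ler1n.
have eta0 : 0 < eta by rewrite invr_gt0 mulr_gt0.
have eta2 : k.+3%:R * eta ^+ 2 <= 4^-1.
  have -> : k.+3%:R * eta ^+ 2 = 4^-1 * k.+3%:R^-1.
    by rewrite /eta; field; rewrite gt_eqF//; apply: lt_le_trans k1.
  by rewrite ler_piMr// invf_le1//; apply: lt_le_trans k1.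
have eta1 : eta <= 1 by rewrite invf_le1 ?mulr_gt0//; move: (k.+3%:R) k1 => x x1; lra.
have [_ _ _ _ pos] := meanI; have [m m0 mP] := pos eta eta0.
exists (m * (9 / 16)); first by rewrite mulr_gt0.
move=> e e16; rewrite -ler_pdivlMr// mulrC -(mean_scale meanI); last exact: ball_weight_bounded.
apply: (mP _ e).
- by apply: bounded_on_mul; [exact: bounded_on_cst|exact: ball_weight_bounded].
- move=> i; have : `|e 0 i| < 5.
    by apply: sqr_lt_norm => //; have := sqnorm_coord e i; lra.
  by rewrite ltr_norml => /andP[? ?]; clearbody eta; split; lra.
- by move=> y _; rewrite mulr_ge0// bump_ge0.
- move=> y ye; have ye4 : sqnorm (y - e) <= 4^-1.
    apply: le_trans eta2.
    rewrite mulr_natl -[k.+3 in leRHS]card_ord -sumr_const; apply: ler_sum => i _.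
    rewrite -[leLHS]real_normK ?num_real// lerXn2r ?nnegrE ?(ltW eta0)//.
    by have := ye i; rewrite !mxE.
  have ye0 := sqnorm_ge0 (y - e); rewrite /ball_weight bumpE; last by lra.
  by rewrite -ler_pdivrMl ?invr_gt0// invrK mulr1; nra.
Qed.

Lemma mean_ge0 h : bounded_on (box 8) h -> (forall z, box 8 z -> 0 <= h z) -> 0 <= I h.
Proof.
move=> bh h0; rewrite -[leLHS](mean_cst meanI); apply: (mean_le meanI) => //.
exact: bounded_on_cst.
Qed.

Lemma ring_weight_mean_gt0 : 0 < I ring_weight.
Proof.
have [m m0 mP] := ball_weight_mass.
pose e : 'rV[R]_k.+3 := 4 *: delta_mx 0 ord0.
have e16 : sqnorm e = 16 :> R.
  rewrite sqnormZ /sqnorm (bigD1 ord0)//= big1 => [|i i0]; rewrite !mxE eqxx /=.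
    by rewrite expr1n addr0 mulr1 expr2; ring.
  by rewrite (negbTE i0) expr0n.
apply: lt_le_trans m0 _; apply: le_trans (mP e e16) _.
apply: (mean_le meanI); [exact: ball_weight_bounded|exact: ring_weight_bounded|].
by move=> z _; exact: ball_weight_le_ring.
Qed.
End Averages.

(** * Comparison of a solution with its means *)

Section SolutionAverages.
Context {R : realType} {k : nat} {I : ('rV[R]_k.+3 -> R) -> R}.
Hypothesis meanI : box_mean 8 I.
Context {r0 : R} {v w : 'rV[R]_k.+3 -> R} {dv dw : 'I_k.+3 -> 'rV[R]_k.+3 -> R}.
Context {ddv ddw : 'I_k.+3 -> 'I_k.+3 -> 'rV[R]_k.+3 -> R}.
Hypothesis r0_pos : 0 < r0.

Definition exterior : set 'rV[R]_k.+3 := [set y | r0 ^+ 2 < sqnorm y].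
Let g y := - \sum_i ddw i i y.

Hypotheses (vC : C1_on exterior v dv) (dvC : forall i, C1_on exterior (dv i) (ddv i)).
Hypotheses (wC : C1_on exterior w dw) (dwC : forall i, C1_on exterior (dw i) (ddw i)).
Hypothesis wE : forall y, exterior y -> w y = \sum_i ddv i i y.
Hypothesis v_gt0 : forall y, exterior y -> 0 < v y.
Hypothesis g_ge0 : forall y, exterior y -> 0 <= g y.
Implicit Types (x y z e : 'rV[R]_k.+3) (s t : R).

Definition ring_mean t : R := I (fun z => ring_weight z * v (t *: z)).

Lemma exterior_open : open exterior.
Proof.
have sc : continuous (fun z : 'rV[R]_k.+3 => sqnorm z).
  move=> z; have [+ _] := @C1_on_sqnorm R k.+3 0 setT z Logic.I.
  by apply: eq_continuous_at => y; rewrite subr0.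
have -> : exterior = (@sqnorm R k.+3) @^-1` [set x | r0 ^+ 2 < x] by [].
by apply: open_comp; [move=> z _; exact: sc|exact: open_gt].
Qed.

Lemma ring_exterior t z : r0 < t -> @shell R k.+3 0 4 36 z -> exterior (t *: z).
Proof.
have r0_gt0 := r0_pos.
rewrite /shell /exterior /= subr0 sqnormZ => rt /andP[z4 _].
have t2 : r0 ^+ 2 < t ^+ 2 by rewrite ltrXn2r ?nnegrE//; lra.
have := sqr_ge0 t; nra.
Qed.

Lemma g_continuous y : exterior y -> {for y, continuous g}.
Proof.
move=> Uy; apply: (@eq_continuous_at _ _ (fun z => -1 * \sum_i ddw i i z)).
  by move=> z; rewrite mulN1r.
apply: continuous_at_mul; first exact: continuous_at_cst.
by apply: continuous_at_sum => i; have [_ /(_ i)[]] := dwC i Uy.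
Qed.

Lemma scale_continuous (h : 'rV[R]_k.+3 -> R) t z : {for t *: z, continuous h} ->
  {for z, continuous (fun x => h (t *: x))}.
Proof.
move=> hc; apply: (@continuous_comp _ _ _ (fun x : 'rV[R]_k.+3 => t *: x) h); last exact: hc.
have := @affine_continuous R k.+3 0 0 t z.
by apply: eq_continuous_at => y; rewrite add0r subr0.
Qed.

(** Monotonicity of [I] alone gives only a nonnegative mean; strictness comes from a positive lower
    bound of [v] on the compact ring, obtained by bounding [1 / v]. *)
Lemma ring_mean_gt0 t : r0 < t -> 0 < ring_mean t.
Proof.
move=> rt.
have cv z : @shell R k.+3 0 4 36 z -> {for z, continuous (fun x => v (t *: x))}.
  by move=> Dz; apply: scale_continuous; have [] := vC (ring_exterior rt Dz).
have [M MP] : bounded_on (@shell R k.+3 0 4 36) (fun z => (v (t *: z))^-1).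
  apply: compact_bounded_on; first exact: (shell_compact ring_shell_box).
  move=> z Dz; apply: (@cvgV _ _ (nbhs z)); last exact: cv.
  by rewrite gt_eqF// v_gt0//; exact: ring_exterior.
have M0 : 0 < `|M| + 1 by rewrite ltr_wpDl.
have lb : (`|M| + 1)^-1 * I ring_weight <= ring_mean t.
  rewrite -(mean_scale meanI); last exact: ring_weight_bounded.
  apply: (mean_le meanI).
  - by apply: bounded_on_mul; [exact: bounded_on_cst|exact: ring_weight_bounded].
  - exact: ring_bounded.
  - move=> z _; have [Dz|/ring_weight_out->] := pselect (@shell R k.+3 0 4 36 z); last first.
      by rewrite mulr0 mul0r.
    rewrite mulrC ler_wpM2l ?ring_weight_ge0//.
    have vz := v_gt0 (ring_exterior rt Dz).
    rewrite -[leRHS]invrK lef_pV2 ?posrE ?invr_gt0//.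
    have := MP z Dz; rewrite gtr0_norm ?invr_gt0// => h.
    by rewrite (le_trans h)// (le_trans (ler_norm M))// lerDl.
by apply: lt_le_trans lb; rewrite mulr_gt0 ?invr_gt0// (ring_weight_mean_gt0 meanI).
Qed.

Lemma ring_mean_system : exists H1 H2 W W1 W2,
  radial_system k [set t | r0 < t] ring_mean H1 H2 W W1 W2
    (fun t => I (fun z => ring_weight z * (sqnorm z ^+ 2 * g (t *: z)))).
Proof.
have [] := @mean_radial_system R k 8 I meanI 0 4 36 ring_shell_box _ _ (@bump_kernel R 4 36)
  exterior 0 exterior_open v w g dv dw ddv ddw [set t | r0 < t] vC dvC wC dwC wE.
- by [].
- by move=> t rt z Dz; rewrite add0r subr0; exact: ring_exterior.
move=> H1 [H2 [W [W1 [W2 sys]]]]; exists H1, H2, W, W1, W2; move: sys.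
congr (radial_system _ _ _ _ _ _ _ _ _); apply/funext => t; congr I; apply/funext => z;
  by rewrite subr0 add0r ?mulrA.
Qed.

(** Put [e = x / s] and dilate the unit ball about [e] into balls about [x]. At [t = 0] the mean is
    [v x] times the mass, at [t = s] it is dominated by the ring mean, and up to [t = 2 s] it
    satisfies the radial system. Then [radial_center_le] gives the factor [4 / 3]. *)
Lemma value_le_ring_mean : exists2 C : R, 0 < C &
  forall x s, r0 < s -> sqnorm x = 16 * s ^+ 2 -> v x <= C * ring_mean s.
Proof.
have r0_gt0 := r0_pos.
have [m m0 mP] := ball_weight_mass meanI.
exists (4 / 3 / m); first by rewrite !divr_gt0.
move=> x s rs xs; have s0 : 0 < s by lra.
have [e eE] : exists e : 'rV[R]_k.+3, e = s^-1 *: x by eexists.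
have e16 : sqnorm e = 16 by rewrite eE sqnormZ xs; field; rewrite gt_eqF.
have seE : s *: e = x by rewrite eE scalerA divff ?gt_eqF// scale1r.
(* With Young weight [1/2], the squared norm is at least [8 s^2 - 4 s^2 = 4 s^2], which exceeds
   [r0^2]. *)
have inU t : 0 <= t <= 2 * s -> forall z, @shell R k.+3 e (-1) 1 z -> exterior (x + t *: (z - e)).
  move=> ts z; rewrite /shell /exterior /= => /andP[_ ze].
  have d0 : 0 < 2^-1 :> R by [].
  have := sqnorm_ge x (x + t *: (z - e)) d0.
  rewrite addrAC subrr add0r sqnormZ xs invrK.
  have := sqnorm_ge0 (z - e); have : t ^+ 2 <= 4 * s ^+ 2 by nra.
  have : r0 ^+ 2 < s ^+ 2 by rewrite ltrXn2r ?nnegrE//; lra.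
  have := sqr_ge0 t; nra.
have [] := @mean_radial_system R k 8 I meanI e (-1) 1 (ball_shell_box e16) _ _
  (@bump_kernel R (-1) 1) exterior x exterior_open v w g dv dw ddv ddw
  [set t | 0 <= t <= 2 * s] vC dvC wC dwC wE _ inU; first by [].
move=> H1 [H2 [W [W1 [W2 sys]]]].
have bdd t (h : 'rV[R]_k.+3 -> R) : 0 <= t <= 2 * s ->
    (forall y, exterior y -> {for y, continuous h}) ->
    forall q : 'rV[R]_k.+3 -> R, (forall z, {for z, continuous q}) ->
    bounded_on (box 8) (fun z => ball_weight e z * (q z * h (x + t *: (z - e)))).
  move=> ts hc q qc.
  exact: (dilation_bounded (ball_shell_box e16) (@bump_kernel R (-1) 1) (inU t ts) qc hc).
have vcont y : exterior y -> {for y, continuous v} by move=> /vC[].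
have bv t : 0 <= t <= 2 * s -> bounded_on (box 8) (fun z => ball_weight e z * v (x + t *: (z - e))).
  move=> ts; have := bdd t v ts vcont (fun=> 1) (fun z => @continuous_at_cst R k.+3 1 z).
  by congr bounded_on; apply/funext => z; rewrite mul1r.
have vpos t z : 0 <= t <= 2 * s -> 0 <= ball_weight e z * v (x + t *: (z - e)).
  move=> ts; have [Dz|nDz] := pselect (@shell R k.+3 e (-1) 1 z).
    by rewrite mulr_ge0 ?bump_ge0// ltW// v_gt0//; exact: inU.
  have [+ _] := kernel_outside (@bump_kernel R (-1) 1) nDz.
  by rewrite /ball_weight => ->; rewrite mul0r.
have qc z : {for z, continuous (fun y => sqnorm (y - e) ^+ 2)}.
  have c1 : {for z, continuous (fun y => sqnorm (y - e))}.
    by have [] := @C1_on_sqnorm R k.+3 e setT z Logic.I.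
  by apply: eq_continuous_at (continuous_at_mul c1 c1) => y; rewrite expr2.
have Gpos t : 0 <= t <= 2 * s ->
    0 <= I (fun z => ball_weight e z * sqnorm (z - e) ^+ 2 * g (x + t *: (z - e))).
  move=> ts; apply: (mean_ge0 meanI).
    have := bdd t g ts g_continuous _ qc.
    by congr bounded_on; apply/funext => z; rewrite mulrA.
  move=> z _; have [Dz|nDz] := pselect (@shell R k.+3 e (-1) 1 z).
    by have gz := g_ge0 (inU t ts z Dz); rewrite mulr_ge0// mulr_ge0 ?bump_ge0 ?sqr_ge0.
  have [+ _] := kernel_outside (@bump_kernel R (-1) 1) nDz.
  by rewrite /ball_weight => ->; rewrite !mul0r.
have Hs := @radial_center_le R k _ _ _ _ _ _ _ s s0 sys Gpos.
have h2s : 0 <= 2 * s <= 2 * s by lra.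
have hs : 0 <= s <= 2 * s by lra.
have h0 : 0 <= 0 :> R by [].
have {}Hs := Hs (mean_ge0 meanI (bv _ h2s) (fun z _ => vpos _ z h2s)).
have v0E : I (fun z => ball_weight e z * v (x + 0 *: (z - e))) = v x * I (ball_weight e).
  rewrite -(mean_scale meanI); last exact: ball_weight_bounded.
  by congr I; apply/funext => z; rewrite scale0r addr0 mulrC.
have hsE z : x + s *: (z - e) = s *: z by rewrite scalerBr seE addrC subrK.
have le_ring : I (fun z => ball_weight e z * v (x + s *: (z - e))) <= ring_mean s.
  apply: (mean_le meanI); first exact: bv.
    by apply: ring_bounded => z Dz; apply: scale_continuous; exact/vcont/ring_exterior.
  move=> z _; rewrite hsE; have [Dz|nDz] := pselect (@shell R k.+3 0 4 36 z).
    rewrite ler_wpM2r ?ball_weight_le_ring// ltW// v_gt0//; exact: ring_exterior.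
  have := ball_weight_le_ring z e16; rewrite ring_weight_out// => bw.
  have -> : ball_weight e z = 0 by apply/eqP; rewrite eq_le bw bump_ge0.
  by rewrite !mul0r.
have vx0 : 0 < v x.
  apply: v_gt0; rewrite /exterior /= xs.
  have : r0 ^+ 2 < s ^+ 2 by rewrite ltrXn2r ?nnegrE//; lra.
  by have := sqr_ge0 s; lra.
have mI := mP e e16; have vm : v x * m <= v x * I (ball_weight e) by rewrite ler_pM2l.
rewrite -/(ball_weight e) in Hs.
have Hs' : 3 * (v x * I (ball_weight e)) <= 4 * I (fun z => ball_weight e z * v (x + s *: (z - e))).
  by rewrite -v0E; exact: Hs.
rewrite mulrAC ler_pdivlMr//; lra.
Qed.
End SolutionAverages.

(** * Inequalities for real powers *)

Section Powers.
Context {R : realType}.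
Implicit Types (a b x y e p s : R).

Lemma powR_le_nonpos e x y : e <= 0 -> 0 < x -> x <= y -> y `^ e <= x `^ e.
Proof.
move=> e0 x0 xy; have y0 : 0 < y by apply: lt_le_trans xy.
rewrite -[e]opprK [y `^ _]powRN [x `^ _]powRN lef_pV2 ?posrE ?powR_gt0//.
by rewrite ge0_ler_powR ?nnegrE ?oppr_ge0 ?(ltW x0) ?(ltW y0).
Qed.

(** A crude affine minorant in place of the true tangent: for [a >= e] write [a^p = a^(p-1) a], and
    for [a < e] the left side is negative. *)
Lemma powR_tangent p a e : 1 < p -> 0 < e -> 0 <= a ->
  e `^ (p - 1) * (a - e) <= a `^ p.
Proof.
move=> p1 e0 a0; have [ae|ae] := leP e a; last first.
  apply: (@le_trans _ _ 0); last exact: powR_ge0.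
  by rewrite mulr_ge0_le0 ?powR_ge0// subr_le0 ltW.
have a1 : 0 < a by apply: lt_le_trans ae.
have -> : a `^ p = a `^ (p - 1) * a.
  rewrite -[X in _ = _ * X]powRr1 ?(ltW a1)// -powRD ?subrK//.
  by rewrite (gt_eqF a1) implybT.
apply: ler_pM; rewrite ?powR_ge0 ?subr_ge0//; last by rewrite gerBl ltW.
by rewrite ge0_ler_powR ?nnegrE ?subr_ge0 ?(ltW p1) ?(ltW e0) ?(ltW a1).
Qed.

Lemma powR_interval_lower e (lo hi : R) : 0 < lo -> lo <= hi ->
  exists2 c : R, 0 < c & forall x, lo <= x <= hi -> c <= x `^ e.
Proof.
move=> lo0 lohi; exists (Num.min (lo `^ e) (hi `^ e)).
  by rewrite lt_min !powR_gt0//; apply: lt_le_trans lohi.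
move=> x /andP[lx xh]; have x0 : 0 < x by apply: lt_le_trans lx.
rewrite ge_min; have [e0|e0] := leP 0 e.
  by rewrite ge0_ler_powR ?nnegrE ?(ltW lo0) ?(ltW x0).
by rewrite (powR_le_nonpos (ltW e0) x0 xh) orbT.
Qed.
End Powers.

(** * Lower bounds for the nonlinearity *)

Section Nonlinearity.
Context {R : realType} {p e : R} {f : R -> R}.
Hypotheses (p_gt1 : 1 < p) (e_lt0 : e < 0).
Hypothesis f_gt0 : forall s : R, 0 < s -> 0 < f s.
Hypothesis f_cont : {within `]0, +oo[, continuous f}.
Hypothesis f_liminf : (0 < limf_einf (fun s : R => (f s / s `^ p)%:E) 0^'+)%E.
Hypothesis f_lim : f s / s `^ e @[s --> +oo] --> +oo.
Implicit Types (s M : R).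

Lemma f_ge_near0 : exists2 c : R, 0 < c & exists2 d : R, 0 < d &
  forall s, 0 < s < d -> c * s `^ p <= f s.
Proof.
move: f_liminf; rewrite limf_einfE => /ereal_sup_gt[_ [V [d /= d0 dV] <-]] infV.
have [c c0 cV] : exists2 c : R, 0 < c & (c%:E <= ereal_inf [set (f x / x `^ p)%:E | x in V])%E.
  move: infV; case: (ereal_inf _) => [r|_|//]; first by rewrite lte_fin => r0; exists r.
  by exists 1 => //; rewrite leey.
exists c => //; exists d => // s /andP[s0 sd].
rewrite -ler_pdivlMr ?powR_gt0// -lee_fin; apply: le_trans cV _.
apply: ereal_inf_lbound; exists s => //; apply: dV => //=.
by rewrite sub0r normrN gtr0_norm.
Qed.

(** The limit inferior settles small [s]; on the remaining compact interval [f] has a positive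
    minimum, which is divided by [M^p]. *)
Lemma f_ge_bounded M : exists2 c : R, 0 < c & forall s, 0 < s <= M -> c * s `^ p <= f s.
Proof.
have p1 := p_gt1; have [c c0 [d d0 cP]] := f_ge_near0.
have [Md|dM] := ltP M d.
  by exists c => // s /andP[s0 sM]; apply: cP; rewrite s0 (le_lt_trans sM).
have M0 : 0 < M by apply: lt_le_trans dM.
have [|x xd xmin] := @EVT_min R f d M dM.
  apply: continuous_subspaceW f_cont => x /=; rewrite !in_itv /= => /andP[dx _].
  by rewrite andbT (lt_le_trans d0).
have x0 : 0 < x by move: xd; rewrite in_itv => /andP[dx _]; apply: lt_le_trans dx.
exists (Num.min c (f x / M `^ p)).
  by rewrite lt_min c0 divr_gt0 ?f_gt0 ?powR_gt0.
move=> s /andP[s0 sM]; have [sd|ds] := ltP s d.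
  by apply: le_trans (cP s _); rewrite ?s0// ler_wpM2r ?powR_ge0// ge_min lexx.
apply: (@le_trans _ _ (f x)); last by apply: xmin; rewrite in_itv /= ds.
apply: (@le_trans _ _ (f x / M `^ p * s `^ p)).
  by rewrite ler_wpM2r ?powR_ge0// ge_min lexx orbT.
rewrite mulrAC ler_pdivrMr ?powR_gt0// ler_pM2l ?f_gt0//.
rewrite ge0_ler_powR ?nnegrE ?(ltW s0) ?(ltW M0)//; lra.
Qed.

Lemma f_ge_large : exists2 M : R, 0 < M & forall s, M <= s -> s `^ e <= f s.
Proof.
have := f_lim => /cvgryPge /(_ 1) [M [_ MP]].
exists (Num.max 1 (M + 1)); first by rewrite lt_max ltr01.
move=> s; rewrite ge_max => /andP[s1 sM]; have s0 : 0 < s by apply: lt_le_trans s1.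
have := MP s; rewrite /= ler_pdivlMr ?powR_gt0// mul1r; apply.
by apply: lt_le_trans sM; rewrite ltrDl.
Qed.

(** Joins both regimes in a form that can be averaged. For large [s], [f s >= s^e >= X^e] since
    [e < 0], and [(s / X)^p <= 1]. For the others, [s^p = X^(p-e) (s / X)^p X^e], and
    [X^(p-e) >= x0^(p-e)]. *)
Lemma f_ge_scaled (x0 : R) : 0 < x0 -> exists2 c : R, 0 < c &
  forall X s, x0 <= X -> 0 < s <= X -> c * (s / X) `^ p * X `^ e <= f s.
Proof.
have p1 := p_gt1; have e1 := e_lt0; move=> x00; have [M M0 fM] := f_ge_large.
have [c c0 cP] := f_ge_bounded M.
exists (Num.min 1 (c * x0 `^ (p - e))).
  by rewrite lt_min ltr01 mulr_gt0 ?powR_gt0.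
move=> X s xX /andP[s0 sX]; have X0 : 0 < X by apply: lt_le_trans xX.
have sX0 : 0 <= s / X by rewrite divr_ge0 ?(ltW s0) ?(ltW X0).
have [sM|Ms] := ltP s M; last first.
  apply: le_trans (fM s Ms); rewrite -[leRHS]mul1r.
  apply: ler_pM; rewrite ?mulr_ge0 ?powR_ge0//; last exact: powR_le_nonpos (ltW e1) s0 sX.
    by rewrite le_min ler01 mulr_ge0 ?powR_ge0 ?(ltW c0).
  rewrite -[leRHS]mulr1; apply: ler_pM; rewrite ?powR_ge0 ?ge_min ?lexx//.
    by rewrite le_min ler01 mulr_ge0 ?powR_ge0 ?(ltW c0).
  have -> : (1 : R) = 1 `^ p by rewrite powR1.
  rewrite ge0_ler_powR ?nnegrE//; first by lra.
  by rewrite ler_pdivrMr// mul1r.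
apply: le_trans (cP s _); last by rewrite s0 ltW.
have Xpe : X `^ p = X `^ (p - e) * X `^ e.
  by rewrite -powRD ?subrK// (gt_eqF X0) implybT.
have -> : (s / X) `^ p = s `^ p / X `^ p.
  rewrite powRM ?invr_ge0 ?(ltW s0) ?(ltW X0)//; congr (_ * _).
  by rewrite -(powR_inv1 (ltW X0)) -powRrM mulN1r powRN.
have k1 : 0 < X `^ (p - e) by exact: powR_gt0.
have k2 : 0 < X `^ e by exact: powR_gt0.
rewrite Xpe.
have -> : Num.min 1 (c * x0 `^ (p - e)) * (s `^ p / (X `^ (p - e) * X `^ e)) * X `^ e =
    (Num.min 1 (c * x0 `^ (p - e)) / X `^ (p - e)) * s `^ p.
  by move: (X `^ e) (X `^ (p - e)) k1 k2 (Num.min _ _) => a b b0 a0 d; field; rewrite !gt_eqF.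
rewrite ler_wpM2r ?powR_ge0// ler_pdivrMr//.
apply: (@le_trans _ _ (c * x0 `^ (p - e))); first by rewrite ge_min lexx orbT.
by rewrite ler_pM2l// ge0_ler_powR ?nnegrE ?(ltW x00) ?(ltW X0)//; lra.
Qed.
End Nonlinearity.

(** * From the differential inequality to the radial one *)

Section ExteriorInequality.
Context {R : realType} {k : nat} {I : ('rV[R]_k.+3 -> R) -> R}.
Hypothesis meanI : box_mean 8 I.
Context {r0 sigma p : R} {f : R -> R} {v w : 'rV[R]_k.+3 -> R}.
Context {dv dw : 'I_k.+3 -> 'rV[R]_k.+3 -> R}.
Context {ddv ddw : 'I_k.+3 -> 'I_k.+3 -> 'rV[R]_k.+3 -> R}.
Hypotheses (r0_pos : 0 < r0) (one_lt_p : 1 < p) (sigma_lt : sigma < 2).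
Hypothesis pE : k.+1%:R * p = k.+4.+1%:R - sigma.
Let U := @exterior R k r0.
Hypotheses (vC : C1_on U v dv) (dvC : forall i, C1_on U (dv i) (ddv i)).
Hypotheses (wC : C1_on U w dw) (dwC : forall i, C1_on U (dw i) (ddw i)).
Hypothesis wE : forall y, U y -> w y = \sum_i ddv i i y.
Hypothesis v_gt0 : forall y, U y -> 0 < v y.
Hypothesis f_gt0 : forall s : R, 0 < s -> 0 < f s.
Hypothesis v_ineq : forall y, U y ->
  euclidean_norm y `^ (- sigma) * f (v y) <= - \sum_i ddw i i y.
Hypothesis f_bounded : forall M : R, exists2 c : R, 0 < c &
  forall s, 0 < s <= M -> c * s `^ p <= f s.
Hypothesis f_scaled : forall x0 : R, 0 < x0 -> exists2 c : R, 0 < c &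
  forall X s, x0 <= X -> 0 < s <= X -> c * (s / X) `^ p * X `^ (-1 + sigma / 2) <= f s.

Let g y := - \sum_i ddw i i y.
Let V := @ring_mean R k I v.
Let G t := I (fun z => ring_weight z * (sqnorm z ^+ 2 * g (t *: z))).
Let inring := @shell R k.+3 0 4 36.

Lemma source_ge0 y : U y -> 0 <= g y.
Proof.
move=> Uy; apply: le_trans (v_ineq Uy).
by rewrite mulr_ge0 ?powR_ge0// ltW// f_gt0// v_gt0.
Qed.

Lemma source_bounded t : r0 < t ->
  bounded_on (box 8) (fun z => ring_weight z * (sqnorm z ^+ 2 * g (t *: z))).
Proof.
move=> rt; apply: ring_bounded => z Dz; apply: continuous_at_mul.
  have c1 : {for z, continuous (@sqnorm R k.+3)}.
    have [+ _] := @C1_on_sqnorm R k.+3 0 setT z Logic.I.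
    by apply: eq_continuous_at => y; rewrite subr0.
  by apply: eq_continuous_at (continuous_at_mul c1 c1) => y; rewrite expr2.
apply: scale_continuous; apply: (g_continuous (r0 := r0) dwC).
exact: (ring_exterior r0_pos rt).
Qed.

Lemma source_mean_ge0 t : r0 < t -> 0 <= G t.
Proof.
move=> rt; apply: (mean_ge0 meanI (source_bounded rt)) => z _.
have [Dz|/ring_weight_out->] := pselect (inring z); last by rewrite mul0r.
rewrite mulr_ge0 ?ring_weight_ge0// mulr_ge0 ?sqr_ge0// source_ge0//.
exact: (ring_exterior r0_pos rt).
Qed.

(* The convex function [x `^ p] is replaced by a secant through the mean, which
   only needs the linearity of the averages. *)
Lemma source_mean_ge : exists2 c : R, 0 < c & forall t m, r0 < t -> 0 <= m ->
  (forall z, inring z -> m * (v (t *: z) / V t) `^ p <= f (v (t *: z))) ->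
  c * t `^ (- sigma) * m <= G t.
Proof.
have r0_gt0 := r0_pos; have p_gt1 := one_lt_p.
have [cs cs0 csP] := @powR_interval_lower R (- sigma) 2 6 ltac:(by []) ltac:(by rewrite ler_nat).
have [kap kapE] : exists kap, kap = I ring_weight by eexists.
have kap0 : 0 < kap by rewrite kapE; exact: ring_weight_mean_gt0.
(* [V] is not normalized: the weighted mean of [v / V - e] is [1 - e * kap], and this choice makes
   it [1/2]. That half turns the 16 in [A], the minimum of [|z|^4] on the ring, into 8. *)
have [e eE] : exists e, e = (2 * kap)^-1 by eexists.
have e0 : 0 < e by rewrite eE invr_gt0 mulr_gt0.
exists (8 * cs * e `^ (p - 1)); first by rewrite !mulr_gt0 ?powR_gt0.
move=> t m rt m0 mf; have t0 : 0 < t by lra.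
have Vt : 0 < V t by exact: (ring_mean_gt0 meanI r0_pos vC v_gt0).
have [A AE] : exists A, A = 16 * cs * t `^ (- sigma) * m * e `^ (p - 1) by eexists.
have Ut z : inring z -> U (t *: z) by exact: (ring_exterior r0_pos rt).
have pt z : inring z -> A * (v (t *: z) / V t - e) <= sqnorm z ^+ 2 * g (t *: z).
  move=> Dz; have vz := v_gt0 (Ut z Dz).
  have /andP[z4 z36] : 4 <= sqnorm z <= 36 by move: Dz; rewrite /inring /shell /= subr0.
  have tan := powR_tangent p_gt1 e0 (divr_ge0 (ltW vz) (ltW Vt)).
  have norm_ge : cs * t `^ (- sigma) <= euclidean_norm (t *: z) `^ (- sigma).
    rewrite /euclidean_norm -/(sqnorm (t *: z)) sqnormZ sqrtrM ?sqr_ge0//.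
    rewrite sqrtr_sqr gtr0_norm// powRM ?sqrtr_ge0 ?(ltW t0)// mulrC.
    rewrite ler_wpM2l ?powR_ge0// csP//.
    have s4 : Num.sqrt 4 = 2 :> R by rewrite (_ : 4 = 2 ^+ 2) ?sqrtr_sqr ?gtr0_norm//; ring.
    have s36 : Num.sqrt 36 = 6 :> R by rewrite (_ : 36 = 6 ^+ 2) ?sqrtr_sqr ?gtr0_norm//; ring.
    by rewrite -s4 -s36 !ler_wsqrtr.
  have gz : cs * t `^ (- sigma) * (m * (v (t *: z) / V t) `^ p) <= g (t *: z).
    apply: le_trans (v_ineq (Ut z Dz)); apply: ler_pM => //; last exact: mf.
      by rewrite mulr_ge0 ?powR_ge0// ltW.
    by rewrite mulr_ge0 ?powR_ge0.
  have cts : 0 <= cs * t `^ (- sigma) * m by rewrite !mulr_ge0 ?powR_ge0 ?(ltW cs0).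
  have h1 : cs * t `^ (- sigma) * m * (e `^ (p - 1) * (v (t *: z) / V t - e)) <= g (t *: z).
    by apply: le_trans gz; rewrite [leRHS]mulrA; apply: ler_wpM2l.
  have g0 := source_ge0 (Ut z Dz).
  have sq16 : 16 <= sqnorm z ^+ 2 by nra.
  apply: (@le_trans _ _ (16 * g (t *: z))); last by rewrite ler_wpM2r.
  by rewrite AE; move: h1; rewrite -(ler_pM2l (_ : 0 < 16))//; lra.
have bv : bounded_on (box 8) (fun z => ring_weight z * v (t *: z)).
  by apply: ring_bounded => z Dz; apply: scale_continuous; have [] := vC (Ut z Dz).
have bc (x : R) h : bounded_on (box 8) h -> bounded_on (box 8) (fun z : 'rV[R]_k.+3 => x * h z).
  by move=> bh; apply: bounded_on_mul => //; exact: bounded_on_cst.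
have b1 := bc (A / V t) _ bv; have b2 := bc (- (A * e)) _ ring_weight_bounded.
have := mean_le meanI (bounded_on_add b1 b2) (source_bounded rt).
rewrite (mean_add meanI b1 b2) (mean_scale meanI _ bv) (mean_scale meanI _ ring_weight_bounded).
rewrite -kapE -/(V t) => GA.
have {}GA : A / V t * V t + - (A * e) * kap <= G t.
  apply: GA => z _; have [Dz|/ring_weight_out->] := pselect (inring z); last first.
    by rewrite !mul0r !mulr0 addr0.
  have := ler_wpM2l (ring_weight_ge0 z) (pt z Dz); apply: le_trans.
  by rewrite le_eqVlt; apply/orP; left; apply/eqP; ring.
apply: le_trans GA; rewrite divfK ?gt_eqF// AE eE le_eqVlt; apply/orP; left; apply/eqP.
by field; rewrite gt_eqF.
Qed.

(** Take [s = t |z| / 4], so that [t z] has length [4 s]. As [2 <= |z| <= 6], [s] lies between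
    [t / 2] and [3 / 2 * t], and [2 * T <= t] ensures [T <= s]. *)
Lemma value_le_mean_near : exists2 C : R, 0 < C & forall T t z, r0 < T -> 2 * T <= t ->
  inring z -> exists2 s, T <= s <= 3 / 2 * t & v (t *: z) <= C * V s.
Proof.
have r0_gt0 := r0_pos.
have [C C0 CP] := value_le_ring_mean meanI r0_pos vC dvC wC dwC wE v_gt0 source_ge0.
exists C => // T t z rT Tt Dz.
have /andP[z4 z36] : 4 <= sqnorm z <= 36 by move: Dz; rewrite /inring /shell /= subr0.
have z0 := sqrtr_ge0 (sqnorm z); have zE := sqr_sqrtr (sqnorm_ge0 z).
have [q qE] : exists q, q = Num.sqrt (sqnorm z) by eexists.
rewrite -qE in z0 zE.
have q2 : 2 <= q by nra.
have q6 : q <= 6 by nra.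
exists (t * q / 4).
  by apply/andP; split; nra.
apply: CP; first by nra.
by rewrite sqnormZ -zE; field.
Qed.

Lemma no_positive_solution : False.
Proof.
have r0_gt0 := r0_pos; have p_gt1 := one_lt_p; have sigma_lt2 := sigma_lt.
have [H1 [H2 [W [W1 [W2 sys]]]]] := ring_mean_system meanI r0_pos vC dvC wC dwC wE.
have [c1 c10 Gge] := source_mean_ge; have [C C0 vCV] := value_le_mean_near.
have Vpos t : r0 < t -> 0 < V t by move=> rt; exact: (ring_mean_gt0 meanI r0_pos vC v_gt0 rt).
(* The second factor is [(t^2)^e] for [e = -1 + sigma / 2]: the quadratic bound on [V] combines with
   the weight [|y|^-sigma] to exactly [t^-2]. *)
have tpow (t : R) : 0 < t -> t `^ (- sigma) * t `^ (-2 + sigma) = t ^- 2.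
  move=> t0; rewrite -powRD; last by rewrite (gt_eqF t0) implybT.
  have -> : - sigma + (-2 + sigma) = - 2 by ring.
  by rewrite powRN powR_mulrn ?ltW.
apply: (radial_nonexistence r0_pos one_lt_p sys Vpos source_mean_ge0).
- move=> c0 D1 D2 T rT c00 Vbd Vdbl.
  have T0 : 0 < T by lra.
  have D20 : 0 < D2.
    have [h1 h2] := Vbd T (lexx _).
    by rewrite -(pmulr_lgt0 _ (exprn_gt0 2 T0)); apply: lt_le_trans h2; lra.
  have D10 : 0 < D1.
    have V2 := Vdbl T T (lexx _) (lexx _) ltac:(lra).
    have VT := Vpos T rT; rewrite -(pmulr_lgt0 _ VT); exact: lt_le_trans VT V2.
  have [C' C'E] : exists C', C' = C * D1 by eexists.
  have C'0 : 0 < C' by rewrite C'E mulr_gt0.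
  have [c c00' cP] := f_scaled (mulr_gt0 C'0 c00).
  have [e eE] : exists e, e = -1 + sigma / 2 by eexists.
  have e0 : e <= 0 by lra.
  have [K KE] : exists K, K = c1 * (c * C' `^ (- p) * (C' * D2) `^ e) by eexists.
  have K0 : 0 < K by rewrite KE !mulr_gt0 ?powR_gt0 ?mulr_gt0.
  exists K => //; exists (2 * T); first by lra.
  move=> t Tt; have t0 : 0 < t by lra.
  have rt : r0 < t by lra.
  have [Vlo Vup] := Vbd t ltac:(lra); have Vt := Vpos t rt.
  have X0 : 0 < C' * V t by rewrite mulr_gt0.
  have Xle : C' * V t <= C' * D2 * t ^+ 2 by rewrite -mulrA ler_pM2l.
  (* [C' * V t] bounds [v] on the ring by doubling. Its power [e <= 0] is bounded below through
     [V t <= D2 * t^2], and [C'^(-p)] converts division by [C' * V t] into division by [V t]. *)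
  have [m mE] : exists m, m = c * C' `^ (- p) * ((C' * D2) `^ e * t `^ (-2 + sigma)) by eexists.
  have m0 : 0 <= m by rewrite mE !mulr_ge0 ?powR_ge0 ?(ltW c00').
  have t2e : (t ^+ 2) `^ e = t `^ (-2 + sigma).
    by rewrite -powR_mulrn ?(ltW t0)// -powRrM eE; congr (_ `^ _); lra.
  have : c1 * t `^ (- sigma) * m <= G t.
    apply: (Gge t m rt m0) => z Dz.
    have vz : 0 < v (t *: z) by apply: v_gt0; exact: (ring_exterior r0_pos rt).
    have [s /andP[Ts st] vs] := vCV T t z rT Tt Dz.
    have vX : v (t *: z) <= C' * V t.
      apply: le_trans vs _; rewrite C'E -mulrA ler_pM2l//; apply: Vdbl => //; lra.
    have := cP (C' * V t) (v (t *: z)); rewrite ler_pM2l// Vlo vz vX => /(_ isT isT).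
    apply: le_trans; rewrite -eE mE.
    have -> : v (t *: z) / (C' * V t) = C'^-1 * (v (t *: z) / V t).
      by field; rewrite !gt_eqF.
    have -> : (C'^-1 * (v (t *: z) / V t)) `^ p = C' `^ (- p) * (v (t *: z) / V t) `^ p.
      have := divr_ge0 (ltW vz) (ltW Vt); move: (_ / _) => x x0.
      by rewrite powRM ?invr_ge0 ?(ltW C'0)// -(powR_inv1 (ltW C'0)) -powRrM mulN1r.
    rewrite -t2e -powRM ?sqr_ge0 ?mulr_ge0 ?(ltW C'0) ?(ltW D20)//.
    have ab : 0 <= c * C' `^ (- p) * (v (t *: z) / V t) `^ p.
      by rewrite !mulr_ge0 ?powR_ge0 ?(ltW c00').
    have := ler_wpM2l ab (powR_le_nonpos e0 X0 Xle).
    by congr (is_true (_ <= _)); ring.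
  rewrite mE => h; rewrite mulrC -ler_pdivrMr ?exprn_gt0// -tpow//.
  by apply: le_trans h; rewrite le_eqVlt KE; apply/orP; left; apply/eqP; ring.
- move=> Cb T rT Vbd; have T0 : 0 < T by lra.
  have [c c00 cP] := f_bounded (C * Cb).
  exists (c1 * c); first by rewrite mulr_gt0.
  exists (2 * T); first by lra.
  move=> t S Tt S0 SV; have t0 : 0 < t by lra.
  have rt : r0 < t by lra.
  have Vt := Vpos t rt.
  have h1 : 0 <= c * V t `^ p by rewrite mulr_ge0 ?powR_ge0 ?ltW.
  have h2 : c1 * t `^ (- sigma) * (c * V t `^ p) <= G t.
    apply: (Gge t _ rt h1) => z Dz.
    have vz : 0 < v (t *: z) by apply: v_gt0; exact: (ring_exterior r0_pos rt).
    have [s /andP[Ts st] vs] := vCV T t z rT Tt Dz.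
    have := cP (v (t *: z)); rewrite vz (le_trans vs) ?ler_pM2l ?Vbd// => /(_ isT).
    apply: le_trans; rewrite -mulrA -powRM ?divr_ge0 ?(ltW vz) ?(ltW Vt)//.
    by rewrite mulrCA divff ?mulr1// gt_eqF.
  have tk : 0 < t ^+ k.+4.+1 by rewrite exprn_gt0.
  rewrite -(ler_pM2l tk) in h2; apply: le_trans h2.
  have SVp : S `^ p <= (t ^+ k.+1 * V t) `^ p.
    by rewrite ge0_ler_powR ?nnegrE ?mulr_ge0 ?exprn_ge0 ?(ltW S0) ?(ltW t0) ?(ltW Vt)//; lra.
  (* The relation [(n - 2) p = n + 2 - sigma] enters here and makes all powers of [t] match. *)
  have E1 : (t ^+ k.+1 * V t) `^ p = t ^+ k.+4.+1 * t `^ (- sigma) * V t `^ p.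
    rewrite powRM ?exprn_ge0 ?(ltW t0) ?(ltW Vt)//; congr (_ * _).
    rewrite -!powR_mulrn ?(ltW t0)// -powRrM pE powRD//.
    by rewrite (gt_eqF t0) implybT.
  have cc : 0 < c1 * c by rewrite mulr_gt0.
  rewrite -(ler_pM2l cc) E1 in SVp; apply: le_trans SVp _.
  by rewrite le_eqVlt; apply/orP; left; apply/eqP; ring.
Qed.
End ExteriorInequality.

Lemma compact_exterior {R : realType} {k : nat} (Omega : set 'rV[R]_k.+3) :
  compact Omega -> exists2 r : R, 0 < r & @exterior R k r `<=` ~` Omega.
Proof.
move=> /compact_bounded[M [_ MP]].
have M1 : M < `|M| + 1 by rewrite (le_lt_trans (ler_norm M))// ltrDl.
have [N NE] : exists N, N = `|M| + 1 by eexists.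
have N1 : 1 <= N by rewrite NE lerDr.
(* Coordinates are bounded by [N], so the squared Euclidean norm is at most [n N^2 <= (n N)^2];
   using [n] instead of its square root avoids a root. *)
exists (k.+3%:R * N); first by rewrite mulr_gt0// (lt_le_trans ltr01).
move=> y /= yr Oy; move: yr; apply/negP; rewrite -leNgt.
have yN i : y 0 i ^+ 2 <= N ^+ 2.
  rewrite -[leLHS]real_normK ?num_real// lerXn2r ?nnegrE//; first by rewrite (le_trans ler01).
  apply: le_trans (coord_le_norm y i) _; rewrite NE; exact: (MP _ M1 y Oy).
apply: (@le_trans _ _ (k.+3%:R * N ^+ 2)).
  by rewrite mulr_natl -[k.+3 in leRHS]card_ord -sumr_const; apply: ler_sum => i _.
rewrite exprMn ler_wpM2r ?sqr_ge0// expr2 ler_peMr ?ler0n// ler1n//.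
Qed.

Theorem theorem1p5 (R : realType) (n : nat) (sigma : R) (Omega : set 'rV[R]_n)
    (f : R -> R)
    (n_ge3 : (3 <= n)%N)
    (sigma_lt2 : sigma < 2)
    (Omega_compact : compact Omega)
    (f_gt0 : forall s : R, 0 < s -> 0 < f s)
    (f_continuous : {within `]0, +oo[, continuous f})
    (f_liminf0 :
       (0 < limf_einf
              (fun s : R =>
                 (f s / s `^ (1 + (4 - sigma) / (n%:R - 2)))%:E) 0^'+)%E)
    (f_lim_pinfty :
       f s / s `^ (-1 + sigma / 2) @[s --> +oo] --> +oo) :
  ~ exists v : 'rV[R]_n -> R,
      [/\ Ck_on (~` Omega) 4 v,
          (forall y, (~` Omega) y -> 0 < v y) &
          (forall y, (~` Omega) y ->
             - laplacian (laplacian v) y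
               >= euclidean_norm y `^ (- sigma) * f (v y))].
Proof.
move=> [v [C4 v_gt0 v_ineq]].
move: n n_ge3 Omega Omega_compact f_liminf0 v C4 v_gt0 v_ineq.
case=> [|[|[|k]]] // _ Omega Omega_compact f_liminf0 v C4 v_gt0 v_ineq.
(* Every weight is supported in [|z| <= 6], so half-width 8 keeps the supports off the boundary
   slabs. *)
have [I meanI] := @exists_box_mean R k.+3 8 ltac:(by []).
have [r0 r0_gt0 sub] := compact_exterior Omega_compact.
have oO : open (~` Omega).
  by apply: closed_openC; apply: compact_closed => //; exact: norm_hausdorff.
have [dv [ddv [dw [ddw [[vC dvC] [wC dwC] wE bE]]]]] := Ck_on_biharmonic oO C4.
have k1 : k.+3%:R - 2 = k.+1%:R :> R by rewrite -(natrB _ (_ : 2 <= k.+3)%N).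
have k0 : 0 < k.+1%:R :> R by rewrite ltr0n.
have p_gt1 : 1 < 1 + (4 - sigma) / (k.+3%:R - 2).
  by rewrite k1 ltrDl divr_gt0//; lra.
have e_lt0 : -1 + sigma / 2 < 0 by lra.
apply: (@no_positive_solution R k I meanI r0 sigma (1 + (4 - sigma) / (k.+3%:R - 2)) f v
  (laplacian v) dv dw ddv ddw r0_gt0 p_gt1 sigma_lt2).
- rewrite k1 mulrDr mulr1 mulrCA divff ?gt_eqF// mulr1.
  by rewrite addrA -natrD addn4.
- exact: C1_on_sub vC.
- by move=> i; exact: C1_on_sub (dvC i).
- exact: C1_on_sub wC.
- by move=> i; exact: C1_on_sub (dwC i).
- by move=> y _; exact: wE.
- by move=> y /sub /v_gt0.
- exact: f_gt0.
- by move=> y /sub Oy; rewrite -bE//; exact: v_ineq.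
- exact: (f_ge_bounded p_gt1 f_gt0 f_continuous f_liminf0).
- exact: (f_ge_scaled p_gt1 e_lt0 f_gt0 f_continuous f_liminf0 f_lim_pinfty).
Qed.
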